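(* Let $A$ be a Hopf algebra and let $(\Lambda^1,\omega)$, with $\Lambda^1$ a right $A$-module and $\omega:A^+\to\Lambda^1$ a right $A$-module map, define the generalised left covariant first order differential calculus $\Omega^1=A\otimes\Lambda^1$, $\mathrm{d}a=a_{(1)}\otimes\omega(\pi(a_{(2)}))$. Left covariant differential exterior algebras $(\Omega,\mathrm{d})$ extending $(\Omega^1,\mathrm{d})$ are in correspondence with pairs $(\Lambda,\delta)$, where $\Lambda=\oplus_{n\ge0}\Lambda^n$ extends $\Lambda^1$ as a graded right $A$-module algebra with $\Lambda^0=k$, and $\delta:\Lambda\to\Lambda$ is a degree $1$ super-derivation such that $$\delta^2=0,$$ $$(\delta\eta)\triangleleft a-\delta(\eta\triangleleft a)=\omega(\pi(a_{(1)}))(\eta\triangleleft a_{(2)})-(-1)^{|\eta|}(\eta\triangleleft a_{(1)})\,\omega(\pi(a_{(2)})),\qquad\forall a\in A,$$ for all homogeneous $\eta\in\Lambda$ of degree $|\eta|$, and $$\delta\omega(a)+\omega(\pi(a_{(1)}))\,\omega(\pi(a_{(2)}))=0,\qquad\forall a\in A^+.$$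
   Context: We work over a field $k$ of characteristic not $2$; Sweedler notation is used. $A^+=\ker\epsilon$ and $\pi(a)=a-\epsilon(a)1$. The bimodule and left comodule structure of $A\otimes\Lambda^1$ are $b.(a\otimes v)=ba\otimes v$, $(a\otimes v).b=ab_{(1)}\otimes v\triangleleft b_{(2)}$, $\Delta_L=\Delta\otimes\mathrm{id}$. A differential exterior algebra $(\Omega,\mathrm{d})$ over $A$ is a graded algebra $\Omega=\oplus_{n\ge0}\Omega^n$ with $\Omega^0=A$ and a degree $1$ map $\mathrm{d}:\Omega\to\Omega$ that is a super-derivation, $\mathrm{d}(uv)=(\mathrm{d}u)v+(-1)^nu\,\mathrm{d}v$ for $u\in\Omega^n$, with $\mathrm{d}^2=0$; it extends $(\Omega^1,\mathrm{d})$ if its degree $\le1$ part is the given calculus. It need not be generated in degrees $0,1$. It is left covariant if $\Omega$ is a left $A$-comodule algebra with graded coaction $\Delta_L$ restricting to the coproduct on $A$ and to the given $\Delta_L$ on $\Omega^1$, and $\mathrm{d}$ is a left comodule map. In the correspondence $\Lambda$ is the algebra of left-invariant forms (with $v\triangleleft a=(Sa_{(1)})\,v\,a_{(2)}$), $\Omega\cong A\otimes\Lambda$ with the cross product algebra structure $(a\otimes\eta)(b\otimes\zeta)=ab_{(1)}\otimes(\eta\triangleleft b_{(2)})\zeta$, $\delta$ is the restriction of $\mathrm{d}$ to $\Lambda$, and $\mathrm{d}(a\otimes\eta)=a_{(1)}\otimes\omega(\pi(a_{(2)}))\eta+a\otimes\delta\eta$. *)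

(* Defs.v *)
From HB Require Import structures.
From mathcomp Require Import all_boot all_order all_algebra.
From mathcomp Require Import boolp.

Set Implicit Arguments.
Unset Strict Implicit.
Unset Printing Implicit Defensive.

Import GRing.Theory.
Local Open Scope ring_scope.
Local Open Scope quotient_scope.

Definition is_bilinear (k : fieldType) (V W U : lmodType k)
    (f : V -> W -> U) : Prop :=
  (forall w, linear (f^~ w)) /\ (forall v, linear (f v)).

(* The tensor product over k: a formal sum of pairs [:: (v_1, w_1); ...]      *)
(* stands for v_1 (x) w_1 + ..., and two formal sums are identified when      *)
(* every bilinear map takes the same value on both.  The universal property   *)
(* is given by tlift_tens, tlift_linear and tens_ext below.                   *)
Section Tensor.
Variables (k : fieldType) (V W : lmodType k).

Definition fsum_eval (U : nmodType) (f : V -> W -> U) (s : seq (V * W)) : U :=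
  \sum_(p <- s) f p.1 p.2.

Definition fsum_eq (s t : seq (V * W)) : Prop :=
  forall (U : lmodType k) (f : V -> W -> U),
    is_bilinear f -> fsum_eval f s = fsum_eval f t.

Definition fsum_eqb (s t : seq (V * W)) : bool := `[< fsum_eq s t >].

Lemma fsum_eqb_equiv : equiv_class_of fsum_eqb.
Proof.
split.
- by move=> s; apply/asboolP => U f.
- by move=> s t; apply/asboolP/asboolP => + U f fb => ->.
- move=> t s u /asboolP st /asboolP tu; apply/asboolP => U f fb.
  by rewrite st // tu.
Qed.

Canonical fsum_equiv := EquivRelPack fsum_eqb_equiv.

Definition tensor := {eq_quot fsum_equiv}.

HB.instance Definition _ := Choice.on tensor.
HB.instance Definition _ := EqQuotient.on tensor.

Lemma fsumP s t : \pi_tensor s = \pi_tensor t <-> fsum_eq s t.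
Proof. by split=> [/eqmodP/asboolP|st] //; apply/eqmodP/asboolP. Qed.

Definition fsum_scale (c : k) (s : seq (V * W)) :=
  [seq (c *: p.1, p.2) | p <- s].

Lemma fsum_eval_cat (U : nmodType) (f : V -> W -> U) s t :
  fsum_eval f (s ++ t) = fsum_eval f s + fsum_eval f t.
Proof. exact: big_cat. Qed.

Lemma fsum_eval_scale (U : lmodType k) (f : V -> W -> U) c s :
  is_bilinear f -> fsum_eval f (fsum_scale c s) = c *: fsum_eval f s.
Proof.
move=> [fl _]; rewrite /fsum_eval big_map scaler_sumr.
by apply: eq_bigr => p _ /=; rewrite (scalable_linear (fl p.2)).
Qed.

Definition tens_add (x y : tensor) : tensor := \pi_tensor (repr x ++ repr y).
Definition tens_scale (c : k) (x : tensor) : tensor :=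
  \pi_tensor (fsum_scale c (repr x)).
Definition tens_zero : tensor := \pi_tensor [::].

Definition tlift (U : nmodType) (f : V -> W -> U) (x : tensor) : U :=
  fsum_eval f (repr x).

Lemma tlift_pi (U : lmodType k) (f : V -> W -> U) s :
  is_bilinear f -> tlift f (\pi_tensor s) = fsum_eval f s.
Proof. by move=> fb; apply: (fsumP _ _).1 fb; rewrite reprK. Qed.

Lemma tensorP (x y : tensor) :
  (forall (U : lmodType k) (f : V -> W -> U), is_bilinear f ->
     tlift f x = tlift f y) -> x = y.
Proof. by move=> xy; rewrite -[x]reprK -[y]reprK; apply/fsumP. Qed.

Lemma tlift_add (U : lmodType k) (f : V -> W -> U) x y :
  is_bilinear f -> tlift f (tens_add x y) = tlift f x + tlift f y.
Proof. by move=> fb; rewrite tlift_pi // fsum_eval_cat. Qed.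

Lemma tlift_scale (U : lmodType k) (f : V -> W -> U) c x :
  is_bilinear f -> tlift f (tens_scale c x) = c *: tlift f x.
Proof. by move=> fb; rewrite tlift_pi // fsum_eval_scale. Qed.

Lemma tlift_zero (U : lmodType k) (f : V -> W -> U) :
  is_bilinear f -> tlift f tens_zero = 0.
Proof. by move=> fb; rewrite tlift_pi // /fsum_eval big_nil. Qed.

Lemma tens_addA : associative tens_add.
Proof. by move=> x y z; apply: tensorP => U f fb; rewrite !tlift_add // addrA. Qed.

Lemma tens_addC : commutative tens_add.
Proof. by move=> x y; apply: tensorP => U f fb; rewrite !tlift_add // addrC. Qed.

Lemma tens_add0 : left_id tens_zero tens_add.
Proof.
by move=> x; apply: tensorP => U f fb; rewrite tlift_add // tlift_zero // add0r.
Qed.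

Lemma tens_addN : left_inverse tens_zero (tens_scale (-1)) tens_add.
Proof.
move=> x; apply: tensorP => U f fb.
by rewrite tlift_add // tlift_scale // tlift_zero // scaleN1r addNr.
Qed.

HB.instance Definition _ :=
  GRing.isZmodule.Build tensor tens_addA tens_addC tens_add0 tens_addN.

Lemma tens_scaleA (a b : k) (x : tensor) :
  tens_scale a (tens_scale b x) = tens_scale (a * b) x.
Proof. by apply: tensorP => U f fb; rewrite !tlift_scale // scalerA. Qed.

Lemma tens_scale1 : left_id 1 tens_scale.
Proof. by move=> x; apply: tensorP => U f fb; rewrite tlift_scale // scale1r. Qed.

Lemma tens_scaleDr : right_distributive tens_scale +%R.
Proof.
move=> a x y; apply: tensorP => U f fb.
by rewrite tlift_scale // !tlift_add // !tlift_scale // scalerDr.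
Qed.

Lemma tens_scaleDl (x : tensor) :
  {morph tens_scale^~ x : a b / a + b}.
Proof.
move=> a b; apply: tensorP => U f fb.
by rewrite tlift_add // !tlift_scale // scalerDl.
Qed.

HB.instance Definition _ :=
  GRing.Zmodule_isLmodule.Build k tensor
    tens_scaleA tens_scale1 tens_scaleDr tens_scaleDl.

Definition tens (v : V) (w : W) : tensor := \pi_tensor [:: (v, w)].

Lemma tlift_tens (U : lmodType k) (f : V -> W -> U) v w :
  is_bilinear f -> tlift f (tens v w) = f v w.
Proof. by move=> fb; rewrite tlift_pi // /fsum_eval big_seq1. Qed.

Lemma tlift_linear (U : lmodType k) (f : V -> W -> U) :
  is_bilinear f -> linear (tlift f).
Proof. by move=> fb c x y; rewrite tlift_add // tlift_scale. Qed.

Lemma tens_bilinear : is_bilinear tens.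
Proof.
split=> [w c v v'|v c w w']; apply: tensorP => U f fb;
  rewrite tlift_linear // !tlift_tens //.
- exact: fb.1.
- exact: fb.2.
Qed.

Lemma tens_sum (x : tensor) : x = \sum_(p <- repr x) tens p.1 p.2.
Proof.
apply: tensorP => U f fb; rewrite -{1}[x]reprK tlift_pi //.
elim: (repr x) => [|p s IHs]; first by rewrite /fsum_eval !big_nil tlift_zero.
by rewrite big_cons tlift_add // tlift_tens // -IHs /fsum_eval big_cons.
Qed.

Lemma tens_ext (U : lmodType k) (g h : {linear tensor -> U}) :
  (forall v w, g (tens v w) = h (tens v w)) -> g =1 h.
Proof.
move=> gh x; rewrite (tens_sum x) !linear_sum.
by apply: eq_bigr => p _; apply: gh.
Qed.

End Tensor.

Notation "V ⊗ W" := (tensor V%type W%type) (at level 40, left associativity) : type_scope.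
Notation "v ⊗ w" := (tens v w) (at level 40, left associativity) : ring_scope.

(* Sweedler notation: \sw_(a1, a2 <- coprod a) E, where E is bilinear in      *)
(* (a1, a2); tlift is only meaningful on bilinear maps.                       *)
Notation "\sw_ ( x , y <- t ) E" := (tlift (fun x y => E) t)
  (at level 36, E at level 36, x binder, y binder, t at level 50,
   format "\sw_ ( x ,  y  <-  t )  E") : ring_scope.

Section TensorMaps.
Variable k : fieldType.

Definition tmap (V W V' W' : lmodType k) (f : V -> V') (g : W -> W')
    (x : V ⊗ W) : V' ⊗ W' :=
  \sw_(v, w <- x) (f v ⊗ g w).

Definition tassoc (U V W : lmodType k) (x : (U ⊗ V) ⊗ W) : U ⊗ (V ⊗ W) :=
  \sw_(uv, w <- x) \sw_(u, v <- uv) (u ⊗ (v ⊗ w)).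

Definition tmul (A B : algType k) (x y : A ⊗ B) : A ⊗ B :=
  \sw_(a, b <- x) \sw_(a', b' <- y) ((a * a') ⊗ (b * b')).

(* The subspace V (x) W' of V (x) W, for a subspace W' of W. *)
Definition in_tensor_r (V W : lmodType k) (W' : W -> Prop) (x : V ⊗ W) : Prop :=
  exists s : seq (V * W),
    (forall p, p \in s -> W' p.2) /\ x = \sum_(p <- s) (p.1 ⊗ p.2).

End TensorMaps.

HB.mixin Record isHopfAlgebra (k : fieldType) A & GRing.Algebra k A := {
  coprod : {linear A -> (A ⊗ A)%type};
  counit : {lrmorphism A -> k | *%R};
  antipode : {linear A -> A};
  coprod1 : coprod 1 = 1 ⊗ 1;
  coprodM : forall a b : A, coprod (a * b) = tmul (coprod a) (coprod b);
  coprodA : forall a : A,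
    tassoc (tmap coprod id (coprod a)) = tmap id coprod (coprod a);
  counitl : forall a : A, \sw_(a1, a2 <- coprod a) (counit a1 *: a2) = a;
  counitr : forall a : A, \sw_(a1, a2 <- coprod a) (counit a2 *: a1) = a;
  antipodel : forall a : A,
    \sw_(a1, a2 <- coprod a) (antipode a1 * a2) = (counit a)%:A;
  antipoder : forall a : A,
    \sw_(a1, a2 <- coprod a) (a1 * antipode a2) = (counit a)%:A
}.

#[short(type="hopfAlgType")]
HB.structure Definition HopfAlgebra (k : fieldType) :=
  {A of GRing.Algebra k A & isHopfAlgebra k A}.

Section AugmentationIdeal.
Variables (k : fieldType) (A : hopfAlgType k).

Definition aug_pred : {pred A} := [pred a | counit a == 0 :> k].

Fact aug_submod_closed : submod_closed aug_pred.
Proof.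
split=> [|c a b]; rewrite !inE ?raddf0 // => /eqP a0 /eqP b0.
by rewrite linearP /= a0 b0 mulr0 addr0.
Qed.

HB.instance Definition _ :=
  GRing.isSubmodClosed.Build k A aug_pred aug_submod_closed.

Record aug_ideal := AugIdeal { aug_val :> A; _ : aug_val \in aug_pred }.

HB.instance Definition _ := [isSub for aug_val].
HB.instance Definition _ := [Choice of aug_ideal by <:].
HB.instance Definition _ := [SubChoice_isSubLmodule of aug_ideal by <:].

Fact aug_proj_subproof (a : A) : a - (counit a : k)%:A \in aug_pred.
Proof. by rewrite inE linearB /= linearZ /= rmorph1 mulr1 subrr. Qed.

Definition aug_proj (a : A) : aug_ideal := AugIdeal (aug_proj_subproof a).

Fact aug_mulr_subproof (x : aug_ideal) (a : A) : aug_val x * a \in aug_pred.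
Proof. by case: x => x /= /eqP x0; rewrite inE rmorphM /= x0 mul0r. Qed.

Definition aug_mulr (x : aug_ideal) (a : A) : aug_ideal :=
  AugIdeal (aug_mulr_subproof x a).

End AugmentationIdeal.

Record is_right_action (k : fieldType) (A : hopfAlgType k) (V : lmodType k)
    (act : V -> A -> V) : Prop := {
  act_bilinear : is_bilinear act;
  act1 : forall v, act v 1 = v;
  actM : forall v a b, act v (a * b) = act (act v a) b
}.

(* The data (Lambda^1, omega). *)
Record calculus (k : fieldType) (A : hopfAlgType k) := Calculus {
  L1 :> lmodType k;
  act_L1 : L1 -> A -> L1;
  omega : {linear aug_ideal A -> L1};
  act_L1P : is_right_action act_L1;
  omega_act : forall x a, omega (aug_mulr x a) = act_L1 (omega x) a
}.

Section FirstOrder.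
Variables (k : fieldType) (A : hopfAlgType k).

(* Delta (x) id : A (x) V -> A (x) (A (x) V) *)
Definition free_coact (V : lmodType k) (x : A ⊗ V) : A ⊗ (A ⊗ V) :=
  \sw_(a, v <- x) \sw_(a1, a2 <- coprod a) (a1 ⊗ (a2 ⊗ v)).

Variable C : calculus A.

Definition Omega1_lmul (b : A) (x : A ⊗ L1 C) : A ⊗ L1 C :=
  \sw_(a, v <- x) ((b * a) ⊗ v).

Definition Omega1_rmul (x : A ⊗ L1 C) (b : A) : A ⊗ L1 C :=
  \sw_(a, v <- x) \sw_(b1, b2 <- coprod b) ((a * b1) ⊗ act_L1 v b2).

Definition Omega1_d (a : A) : A ⊗ L1 C :=
  \sw_(a1, a2 <- coprod a) (a1 ⊗ omega C (aug_proj a2)).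

End FirstOrder.

Section Graded.
Variable k : fieldType.

Record is_direct_sum (V : lmodType k) (gr : nat -> V -> Prop) : Prop := {
  gr0 : forall n, gr n 0;
  gr_lin : forall n c x y, gr n x -> gr n y -> gr n (c *: x + y);
  gr_span : forall x, exists N (f : nat -> V),
    (forall n, gr n (f n)) /\ x = \sum_(n < N) f n;
  gr_indep : forall N (f : nat -> V), (forall n, gr n (f n)) ->
    \sum_(n < N) f n = 0 -> forall n, (n < N)%N -> f n = 0
}.

Record is_graded_algebra (B : algType k) (gr : nat -> B -> Prop) : Prop := {
  gr_sum : is_direct_sum gr;
  gr1 : gr 0 1;
  grM : forall m n x y, gr m x -> gr n y -> gr (m + n)%N (x * y)
}.

Record is_super_derivation (B : algType k) (gr : nat -> B -> Prop)
    (d : B -> B) : Prop := {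
  sder_deg : forall n u, gr n u -> gr n.+1 (d u);
  sder_leibniz : forall n u v, gr n u ->
    d (u * v) = d u * v + (-1) ^+ n * (u * d v)
}.

End Graded.

Section Structures.
Variables (k : fieldType) (A : hopfAlgType k) (C : calculus A).

Record is_comodule_algebra (B : algType k) (cB : B -> A ⊗ B) : Prop := {
  coactA : forall x, tassoc (tmap coprod id (cB x)) = tmap id cB (cB x);
  coact_counit : forall x, \sw_(a, y <- cB x) (counit a *: y) = x;
  coact1 : cB 1 = 1 ⊗ 1;
  coactM : forall x y, cB (x * y) = tmul (cB x) (cB y)
}.

(* Left covariant differential exterior algebras extending (Omega^1, d); the  *)
(* equalities Omega^0 = A and Omega^1 = A (x) Lambda^1 are part of the data,  *)
(* as the embeddings dea_i0 and dea_i1.                                       *)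
Record lcdea := LCDEA {
  Om :> algType k;
  Om_gr : nat -> Om -> Prop;
  Om_d : {linear Om -> Om};
  Om_coact : {linear Om -> (A ⊗ Om)%type};
  Om_i0 : {lrmorphism A -> Om};
  Om_i1 : {linear (A ⊗ L1 C)%type -> Om};
  Om_graded : is_graded_algebra Om_gr;
  Om_i0_inj : injective Om_i0;
  Om_i0_im : forall x, Om_gr 0 x <-> exists a, x = Om_i0 a;
  Om_i1_inj : injective Om_i1;
  Om_i1_im : forall x, Om_gr 1 x <-> exists y, x = Om_i1 y;
  Om_i1_lmul : forall b y, Om_i1 (Omega1_lmul b y) = Om_i0 b * Om_i1 y;
  Om_i1_rmul : forall y b, Om_i1 (Omega1_rmul y b) = Om_i1 y * Om_i0 b;
  Om_sder : is_super_derivation Om_gr Om_d;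
  Om_dd : forall x, Om_d (Om_d x) = 0;
  Om_d_i0 : forall a, Om_d (Om_i0 a) = Om_i1 (Omega1_d C a);
  Om_comodalg : is_comodule_algebra Om_coact;
  Om_coact_gr : forall n x, Om_gr n x -> in_tensor_r (Om_gr n) (Om_coact x);
  Om_coact_i0 : forall a, Om_coact (Om_i0 a) = tmap id Om_i0 (coprod a);
  Om_coact_i1 : forall y, Om_coact (Om_i1 y) = tmap id Om_i1 (free_coact y);
  Om_coact_d : forall x, Om_coact (Om_d x) = tmap id Om_d (Om_coact x)
}.

(* Pairs (Lambda, delta); the equality of the degree 1 part with the given    *)
(* Lambda^1 is the embedding La_j.                                            *)
Record ldpair := LDPair {
  La :> algType k;
  La_gr : nat -> La -> Prop;
  La_act : La -> A -> La;
  La_j : {linear L1 C -> La};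
  La_delta : {linear La -> La};
  La_graded : is_graded_algebra La_gr;
  La_gr0 : forall x, La_gr 0 x <-> exists c : k, x = c%:A;
  La_j_inj : injective La_j;
  La_j_im : forall x, La_gr 1 x <-> exists v, x = La_j v;
  La_j_act : forall v a, La_j (act_L1 v a) = La_act (La_j v) a;
  La_actP : is_right_action La_act;
  La_act_gr : forall n x a, La_gr n x -> La_gr n (La_act x a);
  La_act_unit : forall a, La_act 1 a = (counit a)%:A;
  La_act_mul : forall x y a,
    La_act (x * y) a = \sw_(a1, a2 <- coprod a) (La_act x a1 * La_act y a2);
  La_sder : is_super_derivation La_gr La_delta;
  La_deltadelta : forall x, La_delta (La_delta x) = 0;
  La_delta_act : forall n eta a, La_gr n eta ->
    La_act (La_delta eta) a - La_delta (La_act eta a) =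
    \sw_(a1, a2 <- coprod a)
       (La_j (omega C (aug_proj a1)) * La_act eta a2)
    - (-1) ^+ n *
      \sw_(a1, a2 <- coprod a)
         (La_act eta a1 * La_j (omega C (aug_proj a2)));
  La_MC : forall a : aug_ideal A,
    La_delta (La_j (omega C a)) +
    \sw_(a1, a2 <- coprod (aug_val a))
       (La_j (omega C (aug_proj a1)) * La_j (omega C (aug_proj a2))) = 0
}.

(* Isomorphisms are the identity on the given degree <= 1 parts. *)
Record is_lcdea_iso (O O' : lcdea) (f : {lrmorphism O -> O'}) : Prop := {
  dea_iso_bij : bijective f;
  dea_iso_gr : forall n x, Om_gr n x <-> Om_gr n (f x);
  dea_iso_d : forall x, f (Om_d O x) = Om_d O' (f x);
  dea_iso_coact : forall x, Om_coact O' (f x) = tmap id f (Om_coact O x);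
  dea_iso_i0 : forall a, f (Om_i0 O a) = Om_i0 O' a;
  dea_iso_i1 : forall y, f (Om_i1 O y) = Om_i1 O' y
}.

Definition lcdea_iso (O O' : lcdea) : Prop :=
  exists f : {lrmorphism O -> O'}, is_lcdea_iso f.

Record is_ldpair_iso (P P' : ldpair) (f : {lrmorphism P -> P'}) : Prop := {
  ldp_iso_bij : bijective f;
  ldp_iso_gr : forall n x, La_gr n x <-> La_gr n (f x);
  ldp_iso_act : forall x a, f (La_act x a) = La_act (f x) a;
  ldp_iso_delta : forall x, f (La_delta P x) = La_delta P' (f x);
  ldp_iso_j : forall v, f (La_j P v) = La_j P' v
}.

Definition ldpair_iso (P P' : ldpair) : Prop :=
  exists f : {lrmorphism P -> P'}, is_ldpair_iso f.

Section CrossProduct.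
Variable P : ldpair.

Definition cross_mul (x y : A ⊗ P) : A ⊗ P :=
  \sw_(a, eta <- x) \sw_(b, zeta <- y)
    \sw_(b1, b2 <- coprod b) ((a * b1) ⊗ (La_act eta b2 * zeta)).

Definition cross_d (x : A ⊗ P) : A ⊗ P :=
  \sw_(a, eta <- x)
    (\sw_(a1, a2 <- coprod a) (a1 ⊗ (La_j P (omega C (aug_proj a2)) * eta))
     + a ⊗ La_delta P eta).

End CrossProduct.

Definition left_invariant (O : lcdea) (x : O) : Prop := Om_coact O x = 1 ⊗ x.

Definition cross_map (O : lcdea) (P : ldpair) (iota : P -> O) (x : A ⊗ P) : O :=
  \sw_(a, eta <- x) (Om_i0 O a * iota eta).

(* iota identifies (Lambda, delta) with the left-invariant forms of Omega,    *)
(* and cross_map iota identifies the cross product A (x) Lambda with Omega.   *)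
Record is_correspondence (O : lcdea) (P : ldpair)
    (iota : {lrmorphism P -> O}) : Prop := {
  corr_inj : injective iota;
  corr_im : forall x, left_invariant x <-> exists eta, x = iota eta;
  corr_gr : forall n eta, La_gr n eta <-> Om_gr n (iota eta);
  corr_j : forall v, iota (La_j P v) = Om_i1 O (1 ⊗ v);
  corr_act : forall eta a, iota (La_act eta a) =
    \sw_(a1, a2 <- coprod a) (Om_i0 O (antipode a1) * iota eta * Om_i0 O a2);
  corr_delta : forall eta, iota (La_delta P eta) = Om_d O (iota eta);
  corr_cross_bij : bijective (cross_map iota);
  corr_cross_one : cross_map iota (1 ⊗ 1) = 1;
  corr_cross_mul : forall x y,
    cross_map iota (cross_mul x y) = cross_map iota x * cross_map iota y;
  corr_cross_gr : forall n x,
    in_tensor_r (La_gr (l := P) n) x <-> Om_gr n (cross_map iota x);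
  corr_cross_d : forall x,
    cross_map iota (cross_d x) = Om_d O (cross_map iota x);
  corr_cross_coact : forall x,
    Om_coact O (cross_map iota x) = tmap id (cross_map iota) (free_coact x)
}.

Definition corresponds (O : lcdea) (P : ldpair) : Prop :=
  exists iota : {lrmorphism P -> O}, is_correspondence iota.

End Structures.

(* Main.v *)
Require Import Defs.
From HB Require Import structures.
From mathcomp Require Import all_boot all_order all_algebra.
From mathcomp Require Import boolp.

(** From [Omega] to [Lambda]: for a left A-module M and a left A-comodule B,
    the relations [F x = x_(-1) . G(x_(0))] and [G x = S(x_(-1)) . F(x_(0))]
    between maps B -> M are equivalent, so G is determined by F.  On the
    left-invariant forms, [v <| a = S(a_(1)) v a_(2)] is therefore the only
    solution of [v a = a_(1) (v <| a_(2))], and each property of it and of the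
    restriction of d follows by comparing two expressions of [v a], [d(v a)],
    [d(d a)] or of their coactions; the behaviour of S with respect to products
    and coproducts is never needed.  The same principle shows that every form is
    [x = x_(-1) P(x_(0))] with [P x = S(x_(-1)) x_(0)] left invariant, whence
    [Omega = A (x) Lambda].  From [Lambda] to [Omega]: the two conditions on
    delta are exactly what makes d on the cross product a super-derivation and
    of square zero.  Isomorphisms are transported along [A (x) Lambda = Omega]
    and restricted to the left-invariant forms. *)

Set Implicit Arguments.
Unset Strict Implicit.
Unset Printing Implicit Defensive.

Import GRing.Theory.
Local Open Scope ring_scope.

(** * Tensor products and Sweedler sums *)

Section Linear.
Variable k : fieldType.
Implicit Types (U V W X : lmodType k) (B : algType k).

Lemma lin_id V : linear (fun x : V => x).
Proof. by []. Qed.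

Lemma linear_at0 V W (f : V -> W) : linear f -> f 0 = 0.
Proof. by move=> lf; have := lf (-1) 0 0; rewrite !scaleN1r !addNr. Qed.

Lemma lin_sum V W (f : V -> W) I (r : seq I) (F : I -> V) :
  linear f -> f (\sum_(i <- r) F i) = \sum_(i <- r) f (F i).
Proof.
move=> lf; apply: (big_morph f) => [x y|]; last exact: linear_at0.
by rewrite -[x]scale1r lf !scale1r.
Qed.

Lemma lin_zero V W : linear (fun _ : V => 0 : W).
Proof. by move=> c x y; rewrite scaler0 addr0. Qed.

Lemma lin_fun V W (f : {linear V -> W}) : linear f.
Proof. by move=> c x y; rewrite linearP. Qed.

Lemma lin_comp U V W (f : V -> W) (g : U -> V) :
  linear f -> linear g -> linear (fun x => f (g x)).
Proof. by move=> lf lg c x y; rewrite lg lf. Qed.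

Lemma lin_lin U V W (f : {linear V -> W}) (g : U -> V) :
  linear g -> linear (fun x => f (g x)).
Proof. exact: (lin_comp (lin_fun f)). Qed.

Lemma lin_mull V B (g : V -> B) b : linear g -> linear (fun x => g x * b).
Proof. by move=> lg c x y; rewrite lg mulrDl scalerAl. Qed.

Lemma lin_mulr V B (g : V -> B) b : linear g -> linear (fun x => b * g x).
Proof. by move=> lg c x y; rewrite lg mulrDr scalerAr. Qed.

Lemma lin_add V W (f g : V -> W) :
  linear f -> linear g -> linear (fun x => f x + g x).
Proof. by move=> lf lg c x y; rewrite lf lg scalerDr addrACA. Qed.

Lemma lin_scale V W (f : V -> W) b : linear f -> linear (fun x => b *: f x).
Proof. by move=> lf c x y; rewrite lf scalerDr !scalerA mulrC. Qed.

Lemma lin_counit V W (A : hopfAlgType k) (g : V -> A) (w : W) :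
  linear g -> linear (fun x => counit (g x) *: w).
Proof. by move=> lg c x y; rewrite lg linearP /= scalerDl scalerA. Qed.

Lemma lin_tensl U V W (g : U -> V) (w : W) :
  linear g -> linear (fun x => g x ⊗ w).
Proof. exact: lin_comp ((tens_bilinear V W).1 w). Qed.

Lemma lin_tensr U V W (g : U -> W) (v : V) :
  linear g -> linear (fun x => v ⊗ g x).
Proof. exact: lin_comp ((tens_bilinear V W).2 v). Qed.

(** The tensor [t] is fixed, so the sum runs over one representative and linearity can be checked
    term by term. When the tensor itself varies, as in [lin_sw_arg], bilinearity of the body is what
    makes the value independent of the representative. *)
Lemma lin_sw_body U V W X (f : U -> V -> W -> X) t :
  (forall v w, linear (fun x => f x v w)) -> linear (fun x => tlift (f x) t).
Proof.
move=> lf c x y; rewrite /tlift /fsum_eval scaler_sumr -big_split /=.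
by apply: eq_bigr => p _; rewrite lf.
Qed.

Lemma lin_sw_arg U V W X (f : V -> W -> X) (g : U -> V ⊗ W) :
  is_bilinear f -> linear g -> linear (fun x => tlift f (g x)).
Proof. by move=> fb; apply: lin_comp (tlift_linear fb). Qed.

Lemma lin_bil1 U V W X (f : V -> W -> X) (g : U -> V) w :
  is_bilinear f -> linear g -> linear (fun x => f (g x) w).
Proof. by move=> fb; apply: lin_comp (fb.1 w). Qed.

Lemma lin_bil2 U V W X (f : V -> W -> X) (g : U -> W) v :
  is_bilinear f -> linear g -> linear (fun x => f v (g x)).
Proof. by move=> fb; apply: lin_comp (fb.2 v). Qed.

Lemma lin_aug V (A : hopfAlgType k) (g : V -> A) :
  linear g -> linear (fun x => aug_proj (g x)).
Proof.
move=> lg c x y; apply: val_inj => /=.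
rewrite lg linearP /= scalerDl scalerBr scalerA.
by rewrite opprD addrACA.
Qed.

End Linear.

(* [refine] and not [apply], which would unfold [linear], a product.          *)
Ltac lin :=
  cbv beta;
  lazymatch goal with
  | |- is_bilinear _ => split; intros ?; lin
  | |- forall _, _ => intros ?; lin
  | |- GRing.linear_for _ _ =>
    first
      [ eassumption
      | exact (@lin_id _ _)
      | exact (@lin_zero _ _ _)
      | refine (lin_add _ _); lin
      | refine (lin_mull _ _); lin
      | refine (lin_mulr _ _); lin
      | refine (lin_tensl _ _); lin
      | refine (lin_tensr _ _); lin
      | refine (lin_aug _); lin
      | refine (lin_counit _ _); lin
      | refine (lin_sw_body _ _); lin
      | refine (lin_sw_arg _ _); lin
      | refine (lin_lin _ _); lin
      | match goal with
        | H : is_bilinear _ |- _ =>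
          first [refine (lin_bil1 _ H _); lin | refine (lin_bil2 _ H _); lin]
        | H : linear _ |- _ => refine (lin_comp H _); lin
        | H : forall _, linear _ |- _ => refine (lin_comp (H _) _); lin
        | H : forall _ _, linear _ |- _ => refine (lin_comp (H _ _) _); lin
        end ]
  end.

Section Sweedler.
Variable k : fieldType.
Implicit Types (U V W X Y : lmodType k) (B : algType k).

(** A Sweedler sum is a finite sum over [repr t], so sums over the same tensor are compared, added
    and exchanged as ordinary sums. Only a change of the tensor, as in [sw_tens] and [sw_tmap],
    calls for bilinearity. *)
Lemma eq_sw V W (X : nmodType) (f g : V -> W -> X) t :
  (forall v w, f v w = g v w) -> tlift f t = tlift g t.
Proof. by move=> fg; apply: eq_bigr => p _; apply: fg. Qed.

Lemma sw_lin V W X Y (h : X -> Y) (f : V -> W -> X) t :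
  linear h -> h (tlift f t) = \sw_(v, w <- t) h (f v w).
Proof. exact: lin_sum. Qed.

Lemma sw_tens V W V' W' X (f : V -> W -> V' ⊗ W') (g : V' -> W' -> X) t :
  is_bilinear g ->
  \sw_(x, y <- \sw_(v, w <- t) f v w) g x y =
  \sw_(v, w <- t) \sw_(x, y <- f v w) g x y.
Proof. by move=> gb; apply: sw_lin; apply: tlift_linear. Qed.

Lemma sw_add V W X (f g : V -> W -> X) t :
  \sw_(v, w <- t) (f v w + g v w) = tlift f t + tlift g t.
Proof. exact: big_split. Qed.

Lemma sw_opp V W X (f : V -> W -> X) t :
  \sw_(v, w <- t) (- f v w) = - tlift f t.
Proof. by rewrite [RHS](sw_lin _ _ (h := -%R)) //; lin. Qed.

Lemma sw_mull V W B (f : V -> W -> B) t b :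
  tlift f t * b = \sw_(v, w <- t) (f v w * b).
Proof. exact: mulr_suml. Qed.

Lemma sw_mulr V W B (f : V -> W -> B) t b :
  b * tlift f t = \sw_(v, w <- t) (b * f v w).
Proof. exact: mulr_sumr. Qed.

Lemma exchange_sw V W V' W' X (f : V -> W -> V' -> W' -> X) s t :
  \sw_(v, w <- s) \sw_(v', w' <- t) f v w v' w' =
  \sw_(v', w' <- t) \sw_(v, w <- s) f v w v' w'.
Proof. exact: exchange_big. Qed.

Lemma sw_id V W (t : V ⊗ W) : \sw_(v, w <- t) (v ⊗ w) = t.
Proof. by rewrite [RHS]tens_sum. Qed.

Lemma sw_tmap V W V' W' X (f : V -> V') (g : W -> W') (h : V' -> W' -> X) t :
  is_bilinear h ->
  \sw_(x, y <- tmap f g t) h x y = \sw_(v, w <- t) h (f v) (g w).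
Proof.
by move=> hb; rewrite /tmap sw_tens //; apply: eq_sw => v w; rewrite tlift_tens.
Qed.

Lemma tmap_linear V W V' W' (f : V -> V') (g : W -> W') :
  linear f -> linear g -> linear (tmap f g).
Proof. by move=> lf lg; apply: tlift_linear; lin. Qed.

Lemma tmap_tens V W V' W' (f : V -> V') (g : W -> W') v w :
  linear f -> linear g -> tmap f g (v ⊗ w) = f v ⊗ g w.
Proof. by move=> lf lg; rewrite /tmap tlift_tens //; lin. Qed.

Lemma tens_ind V W (Q : V ⊗ W -> Prop) :
  Q 0 -> (forall x y, Q x -> Q y -> Q (x + y)) -> (forall v w, Q (v ⊗ w)) ->
  forall t, Q t.
Proof.
by move=> Q0 QD Qt t; rewrite (tens_sum t); apply: big_ind => // p _.
Qed.

Lemma tens_eq_linear V W X (g h : V ⊗ W -> X) :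
  linear g -> linear h -> (forall v w, g (v ⊗ w) = h (v ⊗ w)) -> g =1 h.
Proof.
move=> lg lh gh t; rewrite -[t]sw_id (sw_lin _ _ lg) (sw_lin _ _ lh).
exact: eq_sw.
Qed.

Lemma sw_zero V W X (t : V ⊗ W) : \sw_(v, w <- t) 0 = 0 :> X.
Proof. exact: big1. Qed.

Lemma tensDr V W (v : V) (w w' : W) : v ⊗ (w + w') = v ⊗ w + v ⊗ w'.
Proof. by rewrite -[w]scale1r (tens_bilinear V W).2 !scale1r. Qed.

Lemma tensZl V W c (v : V) (w : W) : (c *: v) ⊗ w = c *: (v ⊗ w).
Proof. exact: (scalable_linear ((tens_bilinear V W).1 w)). Qed.

Lemma tensZr V W c (v : V) (w : W) : v ⊗ (c *: w) = c *: (v ⊗ w).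
Proof. exact: (scalable_linear ((tens_bilinear V W).2 v)). Qed.

Lemma tens0r V W (v : V) : v ⊗ 0 = 0 :> V ⊗ W.
Proof. exact: linear_at0 ((tens_bilinear V W).2 v). Qed.

Lemma tens_swr V W V' W' (v : V) (f : V' -> W' -> W) t :
  v ⊗ tlift f t = \sw_(x, y <- t) (v ⊗ f x y).
Proof. exact: (sw_lin _ _ ((tens_bilinear V W).2 v)). Qed.

End Sweedler.

Lemma signr_scale (k : fieldType) (B : algType k) n (x : B) :
  (-1) ^+ n * x = (-1) ^+ n *: x.
Proof.
elim: n => [|n IHn]; first by rewrite mul1r scale1r.
by rewrite !exprS -mulrA IHn !mulN1r scaleNr.
Qed.

(** Here [q] is a linear projection onto the image of [f]. Pointwise preimages of [q v] are chosen,
    and injectivity of [f] makes the choice linear. The retraction [r] can then be tensored with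
    [A], which is how injectivity and images pass from [f] to [tmap id f]. *)
Lemma linear_section (k : fieldType) (U V : lmodType k) (f : U -> V)
    (q : V -> V) :
  linear f -> injective f -> linear q -> (forall v, exists u, q v = f u) ->
  (forall u, q (f u) = f u) ->
  exists r : V -> U, [/\ linear r, cancel f r & forall v, f (r v) = q v].
Proof.
move=> lf fI lq qf qfK; pose r v := projT1 (cid (qf v)).
have fr v : f (r v) = q v by rewrite /r; case: cid.
exists r; split=> // [c v w|u]; apply: fI; first by rewrite lf !fr lq.
by rewrite fr.
Qed.

Lemma tmap_comp (k : fieldType) (V W W' W'' : lmodType k) (f : W' -> W'')
    (g : W -> W') (t : V ⊗ W) : linear f ->
  tmap id f (tmap id g t) = tmap id (f \o g) t.
Proof. by move=> lf; rewrite [LHS]sw_tmap //; lin. Qed.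

Lemma tmap_id (k : fieldType) (V W : lmodType k) (f : W -> W) (t : V ⊗ W) :
  f =1 id -> tmap id f t = t.
Proof. by move=> fE; rewrite -[RHS]sw_id; apply: eq_sw => v w; rewrite fE. Qed.

Lemma tmul_tens (k : fieldType) (R S : algType k) (a a' : R) (b b' : S) :
  tmul (a ⊗ b) (a' ⊗ b') = (a * a') ⊗ (b * b').
Proof. by rewrite /tmul !tlift_tens //; lin. Qed.

Lemma tmul_bil (k : fieldType) (A B : algType k) : is_bilinear (@tmul k A B).
Proof. by rewrite /tmul; lin. Qed.

Lemma lrmorphism_exists (k : fieldType) (B B' : algType k) (f : B -> B') :
  linear f -> monoid_morphism f -> exists g : {lrmorphism B -> B'}, g =1 f.
Proof.
move=> lf mf.
pose g : {lrmorphism B -> B'} := HB.pack f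
  (GRing.isLinear.Build k B B' *:%R f lf)
  (GRing.isMonoidMorphism.Build B B' f mf).
by exists g.
Qed.

Lemma linear_can (k : fieldType) (V W : lmodType k) (f : V -> W) (g : W -> V) :
  linear f -> injective f -> cancel g f -> linear g.
Proof. by move=> lf fI gK c x y; apply: fI; rewrite lf !gK. Qed.

(** * Comodules over a Hopf algebra and inversion by the antipode *)

Section Comodule.
Variables (k : fieldType) (A : hopfAlgType k).

(** The common ground of [A] with its coproduct and of the forms with their coaction:
    coassociativity and inversion by the antipode are proved once and used for both. *)
Record is_comodule (B : lmodType k) (cB : B -> A ⊗ B) : Prop := {
  comod_linear : linear cB;
  comodA : forall x, tassoc (tmap coprod id (cB x)) = tmap id cB (cB x);
  comod_counit : forall x, \sw_(a, y <- cB x) (counit a *: y) = x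
}.

Lemma coprod_comodule : is_comodule (@coprod k A).
Proof. by split; [exact: lin_fun|exact: coprodA|exact: counitl]. Qed.

Section Coassociativity.
Variables (B : lmodType k) (cB : B -> A ⊗ B) (cBP : is_comodule cB).
Variable X : lmodType k.

Lemma sw_coassoc (f : A -> A -> B -> X) b :
  (forall y z, linear (fun x => f x y z)) ->
  (forall x z, linear (fun y => f x y z)) ->
  (forall x y, linear (fun z => f x y z)) ->
  \sw_(a, y <- cB b) \sw_(a1, a2 <- coprod a) f a1 a2 y =
  \sw_(a, y <- cB b) \sw_(a', y' <- cB y) f a a' y'.
Proof.
move=> f1 f2 f3; have lB := comod_linear cBP.
(* The trilinear [f] is read as a bilinear map on [A] and [A ⊗ B], and evaluated on both sides of
   the coassociativity axiom. *)
have := congr1 (tlift (fun a t => \sw_(a', y <- t) f a a' y)) (comodA cBP b).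
have fb x : is_bilinear (f x) by lin.
rewrite sw_tmap; last by lin.
move=> <-; rewrite /tassoc /tmap !sw_tens; try by lin.
apply: eq_sw => a y; rewrite tlift_tens; last by lin.
rewrite sw_tens; last by lin.
by apply: eq_sw => a1 a2; rewrite !tlift_tens //; lin.
Qed.

Lemma sw_counit (f : B -> X) b :
  linear f -> \sw_(a, y <- cB b) (counit a *: f y) = f b.
Proof.
move=> lf; rewrite -[in RHS](comod_counit cBP b) (sw_lin _ _ lf).
by apply: eq_sw => a y; rewrite (scalable_linear lf).
Qed.

End Coassociativity.

Variable X : lmodType k.

Lemma sw_counitr (f : A -> X) b :
  linear f -> \sw_(a1, a2 <- coprod b) (counit a2 *: f a1) = f b.
Proof.
move=> lf; rewrite -[in RHS](counitr b) (sw_lin _ _ lf).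
by apply: eq_sw => a y; rewrite (scalable_linear lf).
Qed.

Lemma sw_coprodM (f : A -> A -> X) a b :
  is_bilinear f ->
  \sw_(x, y <- coprod (a * b)) f x y =
  \sw_(a1, a2 <- coprod a) \sw_(b1, b2 <- coprod b) f (a1 * b1) (a2 * b2).
Proof.
move=> fb; rewrite coprodM /tmul sw_tens //; apply: eq_sw => a1 a2.
by rewrite sw_tens //; apply: eq_sw => b1 b2; rewrite tlift_tens.
Qed.

Lemma sw_coprod1 (f : A -> A -> X) :
  is_bilinear f -> \sw_(x, y <- coprod 1) f x y = f 1 1.
Proof. by move=> fb; rewrite coprod1 tlift_tens. Qed.

Lemma antipode1 : antipode 1 = 1 :> A.
Proof.
have := antipodel (1 : A).
by rewrite rmorph1 scale1r coprod1 tlift_tens ?mulr1 //; lin.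
Qed.

End Comodule.

Section Inversion.
Variables (k : fieldType) (A : hopfAlgType k).
Variables (B M : lmodType k) (cB : B -> A ⊗ B) (cBP : is_comodule cB).
Variables (lm : A -> M -> M) (lm_bil : is_bilinear lm).
Hypotheses (lm1 : forall m, lm 1 m = m)
  (lmM : forall a b m, lm (a * b) m = lm a (lm b m)).

(** Substituting the expression of [F] puts [S(x_(-2)) x_(-1)] in front of [G(x_(0))];
    coassociativity brings the two factors under one coproduct, where [antipodel] turns them into a
    counit. *)
Lemma antipode_cancel (F G : B -> M) : linear G ->
  (forall x, F x = \sw_(a, y <- cB x) lm a (G y)) ->
  forall x, G x = \sw_(a, y <- cB x) lm (antipode a) (F y).
Proof.
move=> lG FG x.
under eq_sw => a y do rewrite FG (sw_lin _ _ (lm_bil.2 _)).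
under eq_sw => a y do under eq_sw => b z do rewrite -lmM.
have lB := comod_linear cBP.
rewrite -(sw_coassoc cBP
  (f := fun a b z => lm (antipode a * b) (G z))); try lin.
have E a y : \sw_(a1, a2 <- coprod a) lm (antipode a1 * a2) (G y) =
    counit a *: G y.
  rewrite -(sw_lin (h := fun z => lm z (G y))); last by lin.
  by rewrite antipodel (scalable_linear (lm_bil.1 _)) lm1.
by under eq_sw => a y do rewrite E; rewrite sw_counit.
Qed.

(** The cancellation rule behind most identities below: two linear maps agree as soon as they agree
    after multiplication by the first Sweedler leg of the argument. *)
Lemma conv_inj (G G' : B -> M) : linear G -> linear G' ->
  (forall x, \sw_(a, y <- cB x) lm a (G y) = \sw_(a, y <- cB x) lm a (G' y)) ->
  G =1 G'.
Proof.
move=> lG lG' GG' x.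
rewrite (antipode_cancel lG (F := fun x => \sw_(a, y <- cB x) lm a (G y))) //.
by rewrite -(antipode_cancel lG' (F := fun x => \sw_(a, y <- cB x) lm a (G y))).
Qed.

(** The converse of [antipode_cancel], by the same regrouping with the other antipode axiom,
    [antipoder]. *)
Lemma antipode_fold (F G : B -> M) : linear F ->
  (forall x, G x = \sw_(a, y <- cB x) lm (antipode a) (F y)) ->
  forall x, F x = \sw_(a, y <- cB x) lm a (G y).
Proof.
move=> lF FG x.
under eq_sw => a y do rewrite FG (sw_lin _ _ (lm_bil.2 _)).
under eq_sw => a y do under eq_sw => b z do rewrite -lmM.
have lB := comod_linear cBP.
rewrite -(sw_coassoc cBP
  (f := fun a b z => lm (a * antipode b) (F z))); try lin.
have E a y : \sw_(a1, a2 <- coprod a) lm (a1 * antipode a2) (F y) =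
    counit a *: F y.
  rewrite -(sw_lin (h := fun z => lm z (F y))); last by lin.
  by rewrite antipoder (scalable_linear (lm_bil.1 _)) lm1.
by under eq_sw => a y do rewrite E; rewrite sw_counit.
Qed.

End Inversion.

(** * Gradings *)

Section GradedProjections.
Variable k : fieldType.

(** A grading is given by predicates, but linear projectors are easier to move: they restrict to
    subspaces that they preserve and can be tensored with [A]. [gproj_sum] asks for every large
    bound [M], so that the bounds of two elements can be joined by [maxn]. *)
Record is_grading_proj (V : lmodType k) (gr : nat -> V -> Prop)
    (p : nat -> V -> V) : Prop := {
  gproj_linear : forall n, linear (p n);
  gproj_gr : forall n x, gr n (p n x);
  gproj_id : forall n x, gr n x -> p n x = x;
  gproj_neq : forall m n x, m != n -> gr n x -> p m x = 0;
  gproj_sum : forall x,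
    exists N, forall M, (N <= M)%N -> x = \sum_(n < M) p n x
}.

Variables (V : lmodType k) (gr : nat -> V -> Prop).

Lemma grading_proj_sum p : is_grading_proj gr p -> is_direct_sum gr.
Proof.
move=> [pl pg pi pn ps].
have p0 n : p n 0 = 0 := linear_at0 (pl n).
split=> [n|n c x y gx gy|x|N f gf f0 n ltnN].
- by rewrite -(p0 n); apply: pg.
- by rewrite -(pi _ _ gx) -(pi _ _ gy) -pl; apply: pg.
- have [N xN] := ps x; exists N, (p^~ x).
  by split=> [n|]; [apply: pg|exact: (xN N)].
- have := congr1 (p n) f0; rewrite (lin_sum _ _ (pl n)) p0.
  rewrite (bigD1 (Ordinal ltnN)) //=.
  rewrite pi // big1 ?addr0 // => i /eqP ni; apply: pn (gf i).
  by apply: contra_notN ni => /eqP ni; apply: val_inj.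
Qed.

Lemma grading_proj_exists : is_direct_sum gr -> exists p, is_grading_proj gr p.
Proof.
move=> [g0 gl gs gi].
(* [dec x f] says that [f] is the family of homogeneous components of [x], with finite support:
   beyond [N] the components vanish and the partial sums are constant. *)
pose dec (x : V) (f : nat -> V) := (forall n, gr n (f n)) /\
  exists N, forall M, (N <= M)%N -> f M = 0 /\ x = \sum_(n < M) f n.
have decP x : exists f, dec x f.
  have [N [f [gf ->]]] := gs x.
  exists (fun n => if (n < N)%N then f n else 0); split=> [n|].
    by case: ifP.
  exists N => M leNM; rewrite ltnNge leNM; split=> //.
  rewrite (big_ord_widen M (fun i => f i) leNM).
  by rewrite big_mkcond.
have dec_lin c x y f g : dec x f -> dec y g ->
    dec (c *: x + y) (fun n => c *: f n + g n).
  move=> [gf [N fN]] [gg [N' gN']]; split=> [n|]; first exact: gl.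
  exists (maxn N N') => M; rewrite geq_max => /andP[leN leN'].
  have [f0 xE] := fN _ leN; have [g0' yE] := gN' _ leN'.
  by rewrite f0 g0' scaler0 addr0 big_split /= -scaler_sumr -xE -yE.
(* The difference of two decompositions of [x] decomposes 0. Cutting the sum at [maxn N n.+1] keeps
   the index [n] in the range of [gr_indep]. *)
have dec_uniq x f g : dec x f -> dec x g -> f =1 g.
  move=> df dg n.
  have [gd [N fN]] := dec_lin (-1) x x f g df dg.
  have [_] := fN (maxn N n.+1) (leq_maxl _ _).
  rewrite scaleN1r addNr => /esym/(gi _ _ gd)/(_ n).
  rewrite leq_max leqnn orbT => /(_ isT)/eqP.
  by rewrite scaleN1r addrC subr_eq0 => /eqP.
have dec_gr n x : gr n x -> dec x (fun m => if m == n then x else 0).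
  move=> gx; split=> [m|]; first by case: eqP => [->|_].
  exists n.+1 => M ltnM; rewrite (gtn_eqF ltnM) //; split=> //.
  rewrite (bigD1 (Ordinal ltnM)) //= eqxx big1 ?addr0 // => i ni.
  by case: eqP => // /(@ord_inj _ i (Ordinal ltnM)) E; rewrite E eqxx in ni.
pose p n x := projT1 (cid (decP x)) n.
have pP x : dec x (p^~ x) by rewrite /p; case: cid.
exists p; split=> [n c x y|n x|n x gx|m n x mn gx|x].
- by rewrite (dec_uniq _ _ _ (pP _) (dec_lin c _ _ _ _ (pP x) (pP y))).
- by case: (pP x).
- by rewrite (dec_uniq _ _ _ (pP _) (dec_gr _ _ gx)) eqxx.
- by rewrite (dec_uniq _ _ _ (pP _) (dec_gr _ _ gx)) (negbTE mn).
- by case: (pP x) => _ [N xN]; exists N => M /xN[].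
Qed.

Variable W : lmodType k.

Lemma in_tensor_r_eq (Q : W -> Prop) (W' : lmodType k) (g h : W -> W')
    (t : V ⊗ W) : linear g -> linear h -> (forall w, Q w -> g w = h w) ->
  in_tensor_r Q t -> tmap id g t = tmap id h t.
Proof.
move=> lg lh gh [s [sQ ->]].
have tl (f : W -> W') : linear f -> linear (tmap id f : V ⊗ W -> V ⊗ W').
  by move=> lf; apply: tmap_linear; lin.
have ts (f : W -> W') : linear f -> tmap id f (\sum_(p <- s) (p.1 ⊗ p.2)) =
    \sum_(p <- s) (p.1 ⊗ f p.2).
  move=> lf; rewrite (lin_sum _ _ (tl _ lf)); apply: eq_bigr => p _.
  by rewrite tmap_tens //; lin.
rewrite !ts //; apply: eq_big_seq => p ps /=.
by rewrite gh //; apply: sQ.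
Qed.

Lemma in_tensor_r_id (Q : W -> Prop) (g : W -> W) (t : V ⊗ W) :
  linear g -> (forall w, Q w -> g w = w) -> in_tensor_r Q t ->
  tmap id g t = t.
Proof.
move=> lg gQ Qt.
by rewrite (in_tensor_r_eq lg (@lin_id k W) gQ Qt) [RHS]tens_sum.
Qed.

Lemma in_tensor_r_tmap (V' : lmodType k) (f : V -> V') (W' : lmodType k)
    (g : W -> W') (Q : W -> Prop) (Q' : W' -> Prop) (t : V ⊗ W) :
  linear f -> linear g -> (forall w, Q w -> Q' (g w)) -> in_tensor_r Q t ->
  in_tensor_r Q' (tmap f g t).
Proof.
move=> lf lg gQ [s [sQ ->]]; exists [seq (f p.1, g p.2) | p <- s]; split.
  by move=> _ /mapP[p ps ->]; apply/gQ/sQ.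
have lt : linear (tmap f g : V ⊗ W -> V' ⊗ W') by apply: tmap_linear.
rewrite (lin_sum _ _ lt) big_map; apply: eq_bigr => p _ /=.
exact: tmap_tens.
Qed.

Variables (Q : W -> Prop).

Lemma in_tensor_r_tens (v : V) w : Q w -> in_tensor_r Q (v ⊗ w).
Proof.
move=> Qw; exists [:: (v, w)]; rewrite big_seq1; split=> // p.
by rewrite inE => /eqP ->.
Qed.

Lemma in_tensor_r_add (x y : V ⊗ W) :
  in_tensor_r Q x -> in_tensor_r Q y -> in_tensor_r Q (x + y).
Proof.
move=> [s [sQ ->]] [t [tQ ->]]; exists (s ++ t); rewrite big_cat; split=> // p.
by rewrite mem_cat => /orP[/sQ|/tQ].
Qed.

Lemma in_tensor_r_sum I (r : seq I) (f : I -> V ⊗ W) :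
  (forall i, in_tensor_r Q (f i)) -> in_tensor_r Q (\sum_(i <- r) f i).
Proof.
move=> fQ; apply: big_ind => //; last exact: in_tensor_r_add.
by exists [::]; rewrite big_nil.
Qed.

End GradedProjections.

(** * Left-invariant forms *)

Lemma free_coact_linear (k : fieldType) (A : hopfAlgType k) (V : lmodType k) :
  linear (@free_coact _ A V).
Proof. by rewrite /free_coact; lin. Qed.

Lemma comodule_algebra_comodule (k : fieldType) (A : hopfAlgType k)
    (B : algType k) (cB : {linear B -> (A ⊗ B)%type}) :
  is_comodule_algebra cB -> is_comodule cB.
Proof. by case=> cA c1 _ _; split=> //; apply: lin_fun. Qed.

Section CrossMap.
Variables (k : fieldType) (A : hopfAlgType k) (C : calculus A).
Variables (O : lcdea C) (P : ldpair C).

Lemma cross_map_linear (iota : P -> O) : linear iota -> linear (cross_map iota).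
Proof. by rewrite /cross_map; lin. Qed.

Lemma cross_map_tens (iota : P -> O) a eta : linear iota ->
  cross_map iota (a ⊗ eta) = Om_i0 O a * iota eta.
Proof. by move=> li; rewrite /cross_map tlift_tens //; lin. Qed.

Lemma La_act_bil : is_bilinear (@La_act _ _ _ P).
Proof. exact: act_bilinear (La_actP P). Qed.

End CrossMap.

Section LeftInvariantForms.
Variables (k : fieldType) (A : hopfAlgType k) (C : calculus A) (O : lcdea C).

Local Notation i0 := (Om_i0 O).
Local Notation i1 := (Om_i1 O).
Local Notation d := (Om_d O).
Local Notation coact := (Om_coact O).

Lemma coact_comodule : is_comodule coact.
Proof. exact: comodule_algebra_comodule (Om_comodalg O). Qed.

Definition linv_pred : {pred O} := [pred x | coact x == 1 ⊗ x].

Lemma linvP x : reflect (left_invariant x) (x \in linv_pred).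
Proof. exact: eqP. Qed.

Fact linv_subalg_closed : subalg_closed linv_pred.
Proof.
split=> [|c x y /linvP cx /linvP cy|x y /linvP cx /linvP cy]; apply/linvP.
- exact: coact1 (Om_comodalg O).
- by rewrite /left_invariant linearP cx cy [RHS](tens_bilinear _ _).2.
- by rewrite /left_invariant (coactM (Om_comodalg O)) cx cy tmul_tens mulr1.
Qed.

HB.instance Definition _ :=
  GRing.isSubalgClosed.Build k O linv_pred linv_subalg_closed.

Record linv := LInv { linv_val :> O; _ : linv_val \in linv_pred }.

HB.instance Definition _ := [isSub for linv_val].
HB.instance Definition _ := [Choice of linv by <:].
HB.instance Definition _ := [SubChoice_isSubAlgebra of linv by <:].

Lemma linv_coact (x : linv) : coact (val x) = 1 ⊗ val x.
Proof. exact/linvP/valP. Qed.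

Definition lmul (a : A) (x : O) : O := i0 a * x.

Lemma lmul_bil : is_bilinear lmul.
Proof. by rewrite /lmul; lin. Qed.

Lemma lmul1 x : lmul 1 x = x.
Proof. by rewrite /lmul rmorph1 mul1r. Qed.

Lemma lmulM a b x : lmul (a * b) x = lmul a (lmul b x).
Proof. by rewrite /lmul rmorphM mulrA. Qed.

(** The diagonal action [a.(b ⊗ y) = a_(1) b ⊗ a_(2) y]. It makes the coaction a map of left
    [A]-modules, by [coact_lmul], so that [conv_inj] can also compare elements of [A ⊗ O]. *)
Definition clmul (a : A) (t : A ⊗ O) : A ⊗ O :=
  \sw_(a1, a2 <- coprod a) \sw_(b, y <- t) ((a1 * b) ⊗ (i0 a2 * y)).

Lemma clmul_bil : is_bilinear clmul.
Proof. by rewrite /clmul; lin. Qed.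

Lemma clmul_tens a b y :
  clmul a (b ⊗ y) = \sw_(a1, a2 <- coprod a) ((a1 * b) ⊗ (i0 a2 * y)).
Proof. by apply: eq_sw => a1 a2; rewrite tlift_tens //; lin. Qed.

Lemma clmul1 t : clmul 1 t = t.
Proof.
rewrite /clmul sw_coprod1; last by lin.
by rewrite rmorph1 -[RHS]sw_id; apply: eq_sw => b y; rewrite !mul1r.
Qed.

Lemma clmulM a b t : clmul (a * b) t = clmul a (clmul b t).
Proof.
rewrite {1 2}/clmul sw_coprodM; last by lin.
apply: eq_sw => a1 a2; rewrite /clmul sw_tens; last by lin.
apply: eq_sw => b1 b2; rewrite sw_tens; last by lin.
by apply: eq_sw => c y; rewrite tlift_tens ?rmorphM ?mulrA //; lin.
Qed.

Lemma coact_lmul a x : coact (i0 a * x) = clmul a (coact x).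
Proof.
rewrite (coactM (Om_comodalg O)) Om_coact_i0 /tmul sw_tmap //.
by lin.
Qed.

Lemma conv_inj_lmul (G G' : A -> O) : linear G -> linear G' ->
  (forall a, \sw_(a1, a2 <- coprod a) (i0 a1 * G a2) =
             \sw_(a1, a2 <- coprod a) (i0 a1 * G' a2)) ->
  G =1 G'.
Proof. exact: (conv_inj (coprod_comodule A) lmul_bil lmul1 lmulM). Qed.

(** Defined on all forms, which lets its identities be proved in [O] itself; that it preserves the
    left-invariant forms is [ract_linv]. *)
Definition ract (x : O) (a : A) : O :=
  \sw_(a1, a2 <- coprod a) (i0 (antipode a1) * x * i0 a2).

Lemma ract_bil : is_bilinear ract.
Proof. by rewrite /ract; lin. Qed.

Lemma ractE x a : x * i0 a = \sw_(a1, a2 <- coprod a) (i0 a1 * ract x a2).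
Proof.
apply: (antipode_fold (coprod_comodule A) lmul_bil lmul1 lmulM
  (F := fun a => x * i0 a)); first by lin.
by move=> b; apply: eq_sw => b1 b2; rewrite /lmul mulrA.
Qed.

Lemma ract_uniq x (G : A -> O) : linear G ->
  (forall a, x * i0 a = \sw_(a1, a2 <- coprod a) (i0 a1 * G a2)) ->
  ract x =1 G.
Proof.
move=> lG xG; apply: conv_inj_lmul => //; first exact: ract_bil.2.
by move=> a; rewrite -ractE.
Qed.

Lemma ract1 x : ract x 1 = x.
Proof.
by rewrite /ract sw_coprod1 ?antipode1 ?rmorph1 ?mulr1 ?mul1r //; lin.
Qed.

(** Cancelling first a leg of [b] and then a leg of [a] turns both sides into [x] times
    [i0 (a * b)], expanded by [ractE]. The antipode of a product never appears. *)
Lemma ractM x a b : ract x (a * b) = ract (ract x a) b.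
Proof.
have rb := ract_bil; move: b; apply: conv_inj_lmul; try by lin.
move=> b; rewrite -ractE; move: a; apply: conv_inj_lmul; try by lin.
move=> a; under [RHS]eq_sw => a1 a2 do rewrite mulrA.
rewrite -sw_mull -ractE -mulrA -rmorphM ractE sw_coprodM; last by lin.
apply: eq_sw => a1 a2; rewrite sw_mulr; apply: eq_sw => b1 b2.
by rewrite mulrA -rmorphM.
Qed.

(** Moving [a] to the left through [y] and then through [x] writes [x y a] as
    [a_(1) (x <| a_(2)) (y <| a_(3))], and [ract_uniq] concludes. *)
Lemma ract_mul x y a :
  ract (x * y) a = \sw_(a1, a2 <- coprod a) (ract x a1 * ract y a2).
Proof.
have rb := ract_bil; move: a; apply: ract_uniq; first by lin.
move=> a; rewrite -mulrA ractE sw_mulr.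
under eq_sw => a1 a2 do rewrite mulrA ractE sw_mull.
under eq_sw => a1 a2 do under eq_sw => a11 a12 do rewrite -mulrA.
rewrite (sw_coassoc (coprod_comodule A)
  (f := fun a1 a2 a3 => i0 a1 * (ract x a2 * ract y a3))); try by lin.
by apply: eq_sw => a1 a2; rewrite sw_mulr.
Qed.

Lemma ract_unit a : ract 1 a = (counit a)%:A.
Proof.
move: a; apply: ract_uniq; first by lin.
move=> a; rewrite mul1r -[in LHS](counitr a) (sw_lin _ _ (lin_fun i0)).
by apply: eq_sw => a1 a2; rewrite linearZ /= -scalerAr mulr1.
Qed.

(** The coaction of [x a] is computed once from [ractE] and once from multiplicativity and the
    invariance of [x]; the leg [a_(1)], acting by [clmul], is then cancelled. *)
Lemma ract_linv x a : left_invariant x -> left_invariant (ract x a).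
Proof.
move=> cx; have rb := ract_bil; rewrite /left_invariant; move: a.
apply: (conv_inj (coprod_comodule A) clmul_bil clmul1 clmulM); try by lin.
move=> a; transitivity (coact (x * i0 a)).
  rewrite ractE (sw_lin _ _ (lin_fun coact)).
  by apply: eq_sw => a1 a2; rewrite coact_lmul.
rewrite (coactM (Om_comodalg O)) Om_coact_i0 cx /tmul tlift_tens; last by lin.
rewrite sw_tmap; last by lin.
under [RHS]eq_sw => a1 a2 do rewrite clmul_tens.
rewrite (sw_coassoc (coprod_comodule A)
  (f := fun a1 a2 a3 => (a1 * 1) ⊗ (i0 a2 * ract x a3))); try by lin.
apply: eq_sw => a1 a2; rewrite ractE mulr1 mul1r.
by rewrite (sw_lin _ _ ((tens_bilinear A O).2 a1)).
Qed.

Lemma d_linv x : left_invariant x -> left_invariant (d x).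
Proof.
move=> cx; rewrite /left_invariant Om_coact_d cx tmap_tens //; lin.
Qed.

Definition linv_proj (x : O) : O :=
  \sw_(a, y <- coact x) (i0 (antipode a) * y).

Lemma linv_proj_linear : linear linv_proj.
Proof. by rewrite /linv_proj; lin. Qed.

Lemma linv_projE x : x = \sw_(a, y <- coact x) (i0 a * linv_proj y).
Proof.
exact: (antipode_fold coact_comodule lmul_bil lmul1 lmulM (F := id)).
Qed.

(** Applying the coaction to [linv_projE] exhibits [coact x] with its first leg acting by [clmul];
    coassociativity gives the same expression with [1 ⊗ linv_proj y], and the leg is cancelled. *)
Lemma linv_proj_linv x : left_invariant (linv_proj x).
Proof.
have lp := linv_proj_linear; rewrite /left_invariant; move: x.
apply: (conv_inj coact_comodule clmul_bil clmul1 clmulM); try by lin.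
move=> x; transitivity (coact x).
  rewrite [in RHS](linv_projE x) (sw_lin _ _ (lin_fun coact)).
  by apply: eq_sw => a y; rewrite coact_lmul.
under [RHS]eq_sw => a y do rewrite clmul_tens.
rewrite (sw_coassoc coact_comodule
  (f := fun a1 a2 y => (a1 * 1) ⊗ (i0 a2 * linv_proj y))); try by lin.
rewrite -[LHS]sw_id; apply: eq_sw => a y; rewrite [in LHS](linv_projE y) mulr1.
by rewrite (sw_lin _ _ ((tens_bilinear A O).2 a)).
Qed.

(** On [A] times an invariant form the projection is [S(a_(1)) a_(2) x], hence the counit. This
    determines the invariant forms of degree 0 and 1 and shows that the cross map is injective. *)
Lemma linv_proj_lmul a x :
  left_invariant x -> linv_proj (i0 a * x) = counit a *: x.
Proof.
move=> cx; rewrite /linv_proj coact_lmul cx clmul_tens sw_tens; last by lin.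
transitivity (lmul (\sw_(a1, a2 <- coprod a) (antipode a1 * a2)) x).
  rewrite (sw_lin _ _ (lmul_bil.1 x)); apply: eq_sw => a1 a2.
  by rewrite tlift_tens; [rewrite mulr1 lmulM|lin].
by rewrite antipodel /lmul linearZ /= rmorph1 -scalerAl mul1r.
Qed.

Lemma linv_proj_id x : left_invariant x -> linv_proj x = x.
Proof.
move=> cx; rewrite -{1}[x]mul1r -(rmorph1 i0) linv_proj_lmul //.
by rewrite rmorph1 scale1r.
Qed.

Definition linv_j (v : L1 C) : O := i1 (1 ⊗ v).

Lemma linv_j_linv v : left_invariant (linv_j v).
Proof.
rewrite /left_invariant /linv_j Om_coact_i1 /free_coact tlift_tens; last by lin.
by rewrite sw_coprod1 ?tmap_tens //; lin.
Qed.

Lemma i1E a v : i1 (a ⊗ v) = i0 a * linv_j v.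
Proof.
by rewrite /linv_j -Om_i1_lmul /Omega1_lmul tlift_tens ?mulr1 //; lin.
Qed.

Lemma linv_j_linear : linear linv_j.
Proof. by rewrite /linv_j; lin. Qed.

Lemma act_L1_bil : is_bilinear (@act_L1 _ _ C).
Proof. exact: act_bilinear (act_L1P C). Qed.

Lemma linv_j_act v a : linv_j (act_L1 v a) = ract (linv_j v) a.
Proof.
have lj := linv_j_linear; have ab := act_L1_bil.
symmetry; move: a; apply: ract_uniq; first by lin.
move=> a; rewrite -Om_i1_rmul /Omega1_rmul tlift_tens; last by lin.
rewrite (sw_lin _ _ (lin_fun i1)); apply: eq_sw => a1 a2.
by rewrite i1E mul1r.
Qed.

Lemma linv_j_inj : injective linv_j.
Proof.
move=> v w /Om_i1_inj vw.
(* Applying the counit to the first factor recovers [u] from [1 ⊗ u]. *)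
have E (u : L1 C) : \sw_(a, u' <- (1 : A) ⊗ u) (counit a *: u') = u.
  by rewrite tlift_tens ?rmorph1 ?scale1r //; lin.
by rewrite -[v]E vw E.
Qed.

Local Notation dform a := (linv_j (omega C (aug_proj a))).

Lemma d_i0 a : d (i0 a) = \sw_(a1, a2 <- coprod a) (i0 a1 * dform a2).
Proof.
rewrite Om_d_i0 /Omega1_d (sw_lin _ _ (lin_fun i1)).
by apply: eq_sw => a1 a2; rewrite i1E.
Qed.

Lemma gr_i0 a : Om_gr 0 (i0 a).
Proof. by apply/Om_i0_im; exists a. Qed.

Lemma gr_linv_j v : Om_gr 1 (linv_j v).
Proof. by apply/Om_i1_im; exists (1 ⊗ v). Qed.

Lemma gr_lmul n a x : Om_gr n x -> Om_gr n (i0 a * x).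
Proof. exact: (grM (Om_graded O) (gr_i0 a)). Qed.

Lemma gr_sw n (V W : lmodType k) (f : V -> W -> O) t :
  (forall v w, Om_gr n (f v w)) -> Om_gr n (tlift f t).
Proof.
have [g0 gl _ _] := gr_sum (Om_graded O).
move=> gf; apply: big_ind => // x y gx gy.
by rewrite -[x]scale1r; apply: gl.
Qed.

Lemma gr_ract n x a : Om_gr n x -> Om_gr n (ract x a).
Proof.
move=> gx; apply: gr_sw => a1 a2; rewrite -[n]addn0.
by apply: (grM (Om_graded O)) (gr_i0 _); apply: gr_lmul.
Qed.

Lemma d_lmul a x : d (i0 a * x) = d (i0 a) * x + i0 a * d x.
Proof.
by rewrite (sder_leibniz (Om_sder O) _ (gr_i0 a)) expr0 mul1r.
Qed.

(** The form [d (x * i0 a)] is computed twice: [E1] first moves [a] to the left by [ractE], while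
    [E2] first applies the Leibniz rule. The two terms of each expansion give the four terms of the
    identity, with [a_(1)] in front. *)
Lemma d_ract n x a : Om_gr n x ->
  ract (d x) a - d (ract x a) =
  \sw_(a1, a2 <- coprod a) (dform a1 * ract x a2)
  - (-1) ^+ n * \sw_(a1, a2 <- coprod a) (ract x a1 * dform a2).
Proof.
move=> gx; have lj := linv_j_linear; have rb := ract_bil.
move: a; apply: conv_inj_lmul; try by lin.
move=> a.
have E1 : \sw_(a1, a2 <- coprod a) (i0 a1 * d (ract x a2)) +
  \sw_(a1, a2 <- coprod a) (i0 a1 *
    \sw_(b1, b2 <- coprod a2) (dform b1 * ract x b2)) = d (x * i0 a).
  rewrite ractE (sw_lin _ _ (lin_fun d)).
  under [RHS]eq_sw => a1 a2 do rewrite d_lmul d_i0 sw_mull addrC.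
  rewrite sw_add; congr (_ + _).
  under [RHS]eq_sw => a1 a2 do under eq_sw => a11 a12 do rewrite -mulrA.
  rewrite [RHS](sw_coassoc (coprod_comodule A)
    (f := fun a1 a2 a3 => i0 a1 * (dform a2 * ract x a3))); try by lin.
  by apply: eq_sw => a1 a2; rewrite sw_mulr.
have E2 : \sw_(a1, a2 <- coprod a) (i0 a1 * ract (d x) a2) +
  \sw_(a1, a2 <- coprod a) (i0 a1 *
    ((-1) ^+ n * \sw_(b1, b2 <- coprod a2) (ract x b1 * dform b2)))
    = d (x * i0 a).
  rewrite (sder_leibniz (Om_sder O) _ gx) -ractE; congr (_ + _).
  under eq_sw => a1 a2 do rewrite mulrA (commr_sign (i0 a1)) -mulrA.
  rewrite -sw_mulr; congr (_ * _); rewrite d_i0 sw_mulr.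
  under [RHS]eq_sw => a1 a2 do rewrite mulrA ractE sw_mull.
  under [RHS]eq_sw => a1 a2 do under eq_sw => a11 a12 do rewrite -mulrA.
  rewrite [RHS](sw_coassoc (coprod_comodule A)
    (f := fun a1 a2 a3 => i0 a1 * (ract x a2 * dform a3))); try by lin.
  by apply: eq_sw => a1 a2; rewrite sw_mulr.
under eq_sw => a1 a2 do rewrite mulrBr.
under [RHS]eq_sw => a1 a2 do rewrite mulrBr.
rewrite !sw_add !sw_opp; apply/eqP; rewrite subr_eq addrAC -subr_eq opprK.
by rewrite E2 addrC E1.
Qed.

(** This is [d (d (i0 b)) = 0], expanded by [d_i0] and the Leibniz rule, after cancelling the leg
    [b_(1)]. *)
Lemma d_dform a :
  d (dform a) + \sw_(a1, a2 <- coprod a) (dform a1 * dform a2) = 0.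
Proof.
have lj := linv_j_linear.
suff: (fun a => d (dform a) + \sw_(a1, a2 <- coprod a) (dform a1 * dform a2))
  =1 fun=> 0 by apply.
apply: conv_inj_lmul; try by lin.
move=> b; transitivity (d (d (i0 b))).
  rewrite d_i0 (sw_lin _ _ (lin_fun d)).
  under [RHS]eq_sw => a1 a2 do rewrite d_lmul d_i0 sw_mull addrC.
  under eq_sw => a1 a2 do rewrite mulrDr.
  rewrite !sw_add; congr (_ + _).
  under [RHS]eq_sw => a1 a2 do under eq_sw => a11 a12 do rewrite -mulrA.
  rewrite [RHS](sw_coassoc (coprod_comodule A)
    (f := fun a1 a2 a3 => i0 a1 * (dform a2 * dform a3))); try by lin.
  by apply: eq_sw => a1 a2; rewrite sw_mulr.
rewrite Om_dd -[LHS](sw_zero _ (coprod b)).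
by apply: eq_sw => a1 a2; rewrite mulr0.
Qed.

End LeftInvariantForms.

(** * The pair formed by the left-invariant forms *)

Section InvariantPair.
Variables (k : fieldType) (A : hopfAlgType k) (C : calculus A) (O : lcdea C).

Local Notation i0 := (Om_i0 O).
Local Notation i1 := (Om_i1 O).
Local Notation d := (Om_d O).
Local Notation coact := (Om_coact O).

(** The coaction preserves the degree of the second factor, so it commutes with the projectors.
    Hence the homogeneous components of a left-invariant form are again left invariant, which gives
    the grading in [linv_graded]. *)
Lemma coact_gproj p n x : is_grading_proj (@Om_gr _ _ _ O) p ->
  coact (p n x) = tmap id (p n) (coact x).
Proof.
move=> pP; have pl := gproj_linear pP.
have lt : linear (tmap id (p n) : A ⊗ O -> A ⊗ O) by apply: tmap_linear; lin.
have [N /(_ _ (leqnn N)) xE] := gproj_sum pP x.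
rewrite xE (lin_sum _ _ (pl n)) !(lin_sum _ _ (lin_fun coact)) (lin_sum _ _ lt).
apply: eq_bigr => i _; move: (p i x) (gproj_gr pP i x) => y gy.
have [<-|ni] := eqVneq (i : nat) n.
  rewrite (gproj_id pP gy) (in_tensor_r_id _ _ (Om_coact_gr gy)) //.
  by move=> w; apply: gproj_id pP _ _.
rewrite (gproj_neq pP _ gy) 1?eq_sym // linear0.
rewrite (in_tensor_r_eq (h := fun=> 0) _ _ _ (Om_coact_gr gy)); try by lin.
- rewrite /tmap -[LHS](sw_zero _ (coact y)); apply: eq_sw => a z.
  by rewrite (linear_at0 (lin_tensr _ (@lin_id _ O))).
- by move=> w gw; rewrite (gproj_neq pP _ gw) // eq_sym.
Qed.

Definition linv_gr n (x : linv O) : Prop := Om_gr n (val x).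

Lemma linv_graded : is_graded_algebra linv_gr.
Proof.
have [p pP] := grading_proj_exists (gr_sum (Om_graded O)).
have pinv n (x : linv O) : p n (val x) \in linv_pred (O := O).
  have pl := gproj_linear pP.
  apply/linvP; rewrite /left_invariant coact_gproj // linv_coact.
  by rewrite tmap_tens //; lin.
split; last 2 first.
- exact: gr1 (Om_graded O).
- by move=> m n x y; apply: (grM (Om_graded O)).
apply: (@grading_proj_sum _ _ _ (fun n x => LInv (pinv n x))); split.
- by move=> n c x y; apply: val_inj; apply: gproj_linear pP _ _ _ _.
- by move=> n x; apply: gproj_gr pP _ _.
- by move=> n x gx; apply: val_inj; apply: gproj_id pP _ _ gx.
- by move=> m n x mn gx; apply: val_inj; apply: gproj_neq pP _ _ _ mn gx.
- move=> x; have [N xN] := gproj_sum pP (val x); exists N => M leNM.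
  by apply: val_inj; rewrite (big_morph val (fun _ _ => erefl) erefl) -xN.
Qed.

Fact linv_ract_subproof (x : linv O) a : ract (val x) a \in linv_pred (O := O).
Proof. exact/linvP/ract_linv/linvP/valP. Qed.

Definition linv_ract x a : linv O := LInv (linv_ract_subproof x a).

Fact linv_d_subproof (x : linv O) : d (val x) \in linv_pred (O := O).
Proof. exact/linvP/d_linv/linvP/valP. Qed.

Definition linv_d x : linv O := LInv (linv_d_subproof x).

Fact linv_d_linear : linear linv_d.
Proof. by move=> c x y; apply: val_inj; rewrite /= linearP. Qed.

HB.instance Definition _ :=
  GRing.isLinear.Build k (linv O) (linv O) *:%R linv_d linv_d_linear.

Fact linv_L1_subproof v : linv_j O v \in linv_pred (O := O).
Proof. exact/linvP/linv_j_linv. Qed.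

Definition linv_L1 v : linv O := LInv (linv_L1_subproof v).

Fact linv_L1_linear : linear linv_L1.
Proof. by move=> c x y; apply: val_inj; apply: linv_j_linear. Qed.

HB.instance Definition _ :=
  GRing.isLinear.Build k (L1 C) (linv O) *:%R linv_L1 linv_L1_linear.

Lemma left_invariant_gr0 (x : O) :
  left_invariant x -> Om_gr 0 x <-> exists c : k, x = c%:A.
Proof.
move=> cx; split=> [/Om_i0_im[a xa]|[c ->]]; last first.
  by rewrite -(rmorph1 i0) -linearZ; apply: gr_i0.
(* The invariant [x] is its own projection, and the projection of [i0 a * 1] is [counit a] times
   1. *)
exists (counit a); have := linv_proj_lmul a (coact1 (Om_comodalg O)).
by rewrite mulr1 -xa linv_proj_id.
Qed.

Lemma left_invariant_gr1 (x : O) :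
  left_invariant x -> Om_gr 1 x <-> exists v, x = linv_j O v.
Proof.
have lp := @linv_proj_linear _ _ _ O.
move=> cx; split=> [/Om_i1_im[y xy]|[v ->]]; last exact: gr_linv_j.
(* Again [x] is its own projection, which sends each [i0 a * linv_j v] to [counit a *: linv_j v];
   the witness is the counit applied to the first factor of [y]. *)
exists (\sw_(a, v <- y) (counit a *: v)).
rewrite -[LHS]linv_proj_id // xy -[y in LHS]sw_id (sw_lin _ _ (lin_fun i1)).
rewrite (sw_lin _ _ lp) (sw_lin _ _ (@linv_j_linear _ _ _ O)).
apply: eq_sw => a v; rewrite i1E linv_proj_lmul; last exact: linv_j_linv.
by rewrite (scalable_linear (@linv_j_linear _ _ _ O)).
Qed.

Lemma val_sw (V W : lmodType k) (f : V -> W -> linv O) t :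
  val (tlift f t) = \sw_(v, w <- t) val (f v w).
Proof. exact: (big_morph val (fun _ _ => erefl) erefl). Qed.

Lemma val_signM n (x : linv O) : val ((-1) ^+ n * x) = (-1) ^+ n * val x.
Proof. by rewrite !signr_scale. Qed.

#[local] Obligation Tactic := idtac.

Program Definition linv_pair : ldpair C :=
  @LDPair k A C (linv O) linv_gr linv_ract linv_L1 linv_d
    linv_graded _ _ _ _ _ _ _ _ _ _ _ _.
Next Obligation.
move=> x; rewrite /linv_gr left_invariant_gr0; last exact: linv_coact.
by split=> [[c xc]|[c ->]]; exists c => //; apply: val_inj.
Qed.
Next Obligation. by move=> v w /(congr1 val)/linv_j_inj. Qed.
Next Obligation.
move=> x; rewrite /linv_gr left_invariant_gr1; last exact: linv_coact.
by split=> [[v xv]|[v ->]]; exists v => //; apply: val_inj.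
Qed.
Next Obligation. by move=> v a; apply: val_inj; apply: linv_j_act. Qed.
Next Obligation.
split=> [|x|x a b].
- split=> [a|x] c y z; apply: val_inj; rewrite /= ?linearP.
    exact: (ract_bil O).1.
  exact: (ract_bil O).2.
- by apply: val_inj; apply: ract1.
- by apply: val_inj; apply: ractM.
Qed.
Next Obligation. by move=> n x a; apply: gr_ract. Qed.
Next Obligation. by move=> a; apply: val_inj; apply: ract_unit. Qed.
Next Obligation.
by move=> x y a; apply: val_inj; rewrite val_sw; apply: ract_mul.
Qed.
Next Obligation.
split=> [n x|n x y gx]; first exact: sder_deg (Om_sder O) _ _.
apply: val_inj; rewrite [LHS](sder_leibniz (Om_sder O) _ gx).
by rewrite [RHS]/(_ + val ((-1) ^+ n * _)) val_signM.
Qed.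
Next Obligation. by move=> x; apply: val_inj; apply: Om_dd. Qed.
Next Obligation.
move=> n x a gx; apply: val_inj; rewrite [LHS](d_ract _ gx).
by rewrite [RHS]/(val _ - val ((-1) ^+ n * _)) val_signM !val_sw.
Qed.
Next Obligation.
move=> a; apply: val_inj; rewrite /= val_sw -[RHS](d_dform O (aug_val a)).
congr (d (linv_j O (omega C _)) + _).
(* The Maurer-Cartan condition is stated on [A^+], where the counit vanishes and [aug_proj] is the
   identity. *)
apply: val_inj => /=; case: a => a /=; rewrite inE => /eqP ->.
by rewrite scale0r subr0.
Qed.
Fact linv_proj_subproof (x : O) : linv_proj x \in linv_pred (O := O).
Proof. exact/linvP/linv_proj_linv. Qed.

Definition linv_retract (x : O) : linv O := LInv (linv_proj_subproof x).

Lemma linv_retract_linear : linear linv_retract.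
Proof. by move=> c x y; apply: val_inj; apply: linv_proj_linear. Qed.

Lemma linv_retract_gr n (x : O) : Om_gr n x -> linv_gr n (linv_retract x).
Proof.
move=> gx; have [p pP] := grading_proj_exists (gr_sum (Om_graded O)).
have pl := gproj_linear pP.
have lp := @linv_proj_linear _ _ _ O.
rewrite /linv_gr /= /linv_proj.
(* The chosen representative of [coact x] may have second entries that are not homogeneous. Applying
   [p n] to the second factor does not change the tensor and makes every term of the sum
   homogeneous. *)
rewrite -(in_tensor_r_id (pl n) (fun w => @gproj_id _ _ _ _ pP n w)
  (Om_coact_gr gx)); rewrite sw_tmap; last by lin.
by apply: gr_sw => a y; apply: gr_lmul; apply: gproj_gr pP _ _.
Qed.

Definition linv_incl (x : linv O) : O := val x.

HB.instance Definition _ :=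
  GRing.isLinear.Build k (linv O) O *:%R linv_incl (fun _ _ _ => erefl).

HB.instance Definition _ := GRing.isMonoidMorphism.Build (linv O) O linv_incl
  (erefl, fun _ _ => erefl).

Local Notation iota := linv_incl.
Local Notation cross := (cross_map (O := O) (P := linv_pair) iota).

Let iota_lin : linear iota := fun _ _ _ => erefl.
Let cross_lin : linear cross :=
  cross_map_linear (P := linv_pair) (iota := linv_incl) iota_lin.
Let cross_tens a eta : cross (a ⊗ eta) = i0 a * iota eta :=
  cross_map_tens (P := linv_pair) a eta iota_lin.

Lemma linv_cross_gr n (x : A ⊗ linv O) :
  in_tensor_r (linv_gr n) x -> Om_gr n (cross x).
Proof.
have [g0 gl _ _] := gr_sum (Om_graded O).
move=> [s [sg ->]]; have lc := cross_lin.
rewrite (lin_sum _ _ lc) big_seq; apply: big_ind => [||p ps] //.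
  by move=> u v gu gv; rewrite -[u]scale1r; apply: gl.
by rewrite cross_tens; apply/gr_lmul/sg.
Qed.

(** The inverse of the cross map is the coaction followed by the projection on the second factor.
    This composite is [linv_projE]; the other, [linv_cross_mapK], follows from [linv_proj_lmul] and
    the counit axiom. *)
Lemma cross_map_linvK (x : O) : cross (tmap id linv_retract (coact x)) = x.
Proof.
rewrite [cross _]sw_tmap; last by lin.
by rewrite [RHS]linv_projE.
Qed.

Lemma linv_cross_coact (x : A ⊗ linv O) :
  coact (cross x) = tmap id cross (free_coact x).
Proof.
have lt : linear (tmap id cross : A ⊗ (A ⊗ linv O) -> _).
  by apply: tmap_linear; lin.
rewrite (sw_lin _ _ (lin_fun coact)) [RHS](sw_lin _ _ lt).
apply: eq_sw => a y; rewrite coact_lmul linv_coact clmul_tens (sw_lin _ _ lt).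
by apply: eq_sw => a1 a2; rewrite tmap_tens ?mulr1 ?cross_tens //; lin.
Qed.

Lemma linv_cross_mapK (x : A ⊗ linv O) :
  tmap id linv_retract (coact (cross x)) = x.
Proof.
have lr := linv_retract_linear.
have lt : linear (tmap id linv_retract : A ⊗ O -> A ⊗ linv O).
  by apply: tmap_linear; lin.
rewrite linv_cross_coact -[RHS]sw_id [LHS]sw_tmap; last by lin.
rewrite /free_coact sw_tens; last by lin.
apply: eq_sw => a y; rewrite sw_tens; last by lin.
rewrite -[in RHS](counitr a) (sw_lin _ _ ((tens_bilinear A (linv O)).1 y)).
apply: eq_sw => a1 a2; rewrite tlift_tens ?cross_tens //; last by lin.
have -> : linv_retract (i0 a2 * iota y) = counit a2 *: y.
  by apply: val_inj; apply/linv_proj_lmul/linvP/valP.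
rewrite (scalable_linear ((tens_bilinear A (linv O)).1 y)).
by rewrite (scalable_linear ((tens_bilinear A (linv O)).2 a1)).
Qed.

Lemma linv_correspondence : is_correspondence (P := linv_pair) linv_incl.
Proof.
split.
- exact: val_inj.
- move=> x; split=> [cx|[y ->]]; last exact: linv_coact.
  by exists (LInv (introT (linvP x) cx)).
- by [].
- by [].
- by [].
- by [].
- by exists (fun x => tmap id linv_retract (coact x));
    [exact: linv_cross_mapK|exact: cross_map_linvK].
- by rewrite cross_tens rmorph1 mul1r.
- move=> x y; rewrite /cross_mul (sw_lin _ _ cross_lin) sw_mull.
  apply: eq_sw => a eta; rewrite sw_mulr (sw_lin _ _ cross_lin).
  apply: eq_sw => b zeta; rewrite (sw_lin _ _ cross_lin).
  rewrite mulrA -[_ * _ * i0 b]mulrA ractE sw_mulr sw_mull.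
  apply: eq_sw => b1 b2; rewrite cross_tens rmorphM.
  by rewrite !mulrA.
- move=> n x; split=> [|gx]; first exact: linv_cross_gr.
  rewrite -[x]linv_cross_mapK.
  apply: in_tensor_r_tmap (Om_coact_gr gx) => //.
    exact: linv_retract_linear.
  exact: linv_retract_gr.
- move=> x; rewrite /cross_d (sw_lin _ _ cross_lin) (sw_lin _ _ (lin_fun d)).
  apply: eq_sw => a eta; rewrite d_lmul d_i0 sw_mull.
  rewrite -[a ⊗ _]scale1r addrC cross_lin scale1r addrC.
  rewrite cross_tens (sw_lin _ _ cross_lin); congr (_ + _).
  by apply: eq_sw => a1 a2; rewrite cross_tens mulrA.
- exact: linv_cross_coact.
Qed.

End InvariantPair.

Lemma lcdea_corresponds (k : fieldType) (A : hopfAlgType k) (C : calculus A)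
  (O : lcdea C) : exists P : ldpair C, corresponds O P.
Proof.
by exists (linv_pair O), (@linv_incl _ _ _ O); apply: linv_correspondence.
Qed.

(** * The cross product *)

Section CrossProductAlgebra.
Variables (k : fieldType) (A : hopfAlgType k) (C : calculus A) (P : ldpair C).

Local Notation j := (La_j P).
Local Notation delta := (La_delta P).
Local Notation act := (@La_act _ _ _ P).
Local Notation dform a := (j (omega C (aug_proj a))).

(** A separate name for [A ⊗ P], so that the cross product ring structure is attached to it and not
    to tensor products in general. *)
Definition cross : Type := (A ⊗ P)%type.

HB.instance Definition _ := GRing.Lmodule.copy cross (A ⊗ P)%type.

Local Notation cmul := (@cross_mul _ _ _ P).

Lemma cross_mul_bil : is_bilinear cmul.
Proof. by have ab := La_act_bil P; rewrite /cross_mul; lin. Qed.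

Lemma cross_mul_tens a eta b zeta : cmul (a ⊗ eta) (b ⊗ zeta) =
  \sw_(b1, b2 <- coprod b) ((a * b1) ⊗ (act eta b2 * zeta)).
Proof.
have ab := La_act_bil P.
by rewrite /cross_mul tlift_tens; [rewrite tlift_tens //|]; lin.
Qed.

(** On pure tensors both sides are sums over two legs of [b] and three legs of [c]. They agree
    because [act] is an action compatible with products, and by coassociativity at [c]. *)
Lemma cross_mulA : associative cmul.
Proof.
have cb := cross_mul_bil; have ab := La_act_bil P.
move=> x y z; move: x.
apply: (tens_eq_linear (h := fun x => cmul (cmul x y) z)); try by lin.
move=> a eta; move: y.
apply: (tens_eq_linear (g := fun y => cmul _ (cmul y z))
  (h := fun y => cmul (cmul _ y) z)); try by lin.
move=> b zeta; move: z.
apply: (tens_eq_linear (g := fun z => cmul _ (cmul _ z))); try by lin.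
move=> c xi; rewrite !cross_mul_tens.
rewrite (sw_lin _ _ (cb.1 (c ⊗ xi))) (sw_lin _ _ (cb.2 (a ⊗ eta))).
under [RHS]eq_sw => b1 b2 do rewrite cross_mul_tens.
rewrite [RHS]exchange_sw.
transitivity (\sw_(c1, c2 <- coprod c) \sw_(c11, c12 <- coprod c1)
  \sw_(b1, b2 <- coprod b)
    ((a * b1 * c11) ⊗ (act (act eta b2) c12 * act zeta c2 * xi))).
  apply: eq_sw => c1 c2; rewrite cross_mul_tens sw_coprodM; last by lin.
  rewrite exchange_sw; apply: eq_sw => c11 c12; apply: eq_sw => b1 b2.
  by rewrite (actM (La_actP P)) !mulrA.
rewrite (sw_coassoc (coprod_comodule A) (f := fun c1 c2 c3 =>
  \sw_(b1, b2 <- coprod b)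
    ((a * b1 * c1) ⊗ (act (act eta b2) c2 * act zeta c3 * xi)))); try by lin.
apply: eq_sw => c1 c2; rewrite exchange_sw; apply: eq_sw => b1 b2.
rewrite La_act_mul sw_mull.
by rewrite (sw_lin _ _ ((tens_bilinear _ _).2 _)).
Qed.

Lemma cross_mul1r : left_id (1 ⊗ 1) cmul.
Proof.
have cb := cross_mul_bil.
apply: tens_eq_linear; try by lin.
move=> a eta; rewrite cross_mul_tens -[in RHS](counitr a).
rewrite (sw_lin _ _ ((tens_bilinear A P).1 eta)).
apply: eq_sw => a1 a2; rewrite mul1r La_act_unit -scalerAl mul1r.
rewrite (scalable_linear ((tens_bilinear A P).2 _)).
by rewrite (scalable_linear ((tens_bilinear A P).1 _)).
Qed.

Lemma cross_mulr1 : right_id (1 ⊗ 1) cmul.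
Proof.
have cb := cross_mul_bil; have ab := La_act_bil P.
apply: (tens_eq_linear (g := cmul^~ _)); try by lin.
move=> a eta; rewrite cross_mul_tens sw_coprod1; last by lin.
by rewrite (act1 (La_actP P)) !mulr1.
Qed.

(** A retraction of [eta |-> 1 ⊗ eta]: it shows that [1 ⊗ 1] is not zero, and later reads off the
    element of [P] behind a left-invariant tensor. *)
Definition cross_counit (x : cross) : P := \sw_(a, eta <- x) (counit a *: eta).

Lemma cross_counit_linear : linear cross_counit.
Proof. by rewrite /cross_counit; lin. Qed.

Lemma cross_counit_tens a eta : cross_counit (a ⊗ eta) = counit a *: eta.
Proof. by rewrite /cross_counit tlift_tens //; lin. Qed.

Fact cross_one_neq0 : 1 ⊗ 1 != 0 :> cross.
Proof.
apply/eqP => /(congr1 cross_counit); rewrite cross_counit_tens.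
rewrite (linear_at0 cross_counit_linear) rmorph1 scale1r.
by apply/eqP/oner_neq0.
Qed.

Fact cross_mulDl : left_distributive cmul +%R.
Proof.
move=> x y z; have := (cross_mul_bil.1 z) 1 x y; by rewrite !scale1r.
Qed.

Fact cross_mulDr : right_distributive cmul +%R.
Proof.
move=> x y z; have := (cross_mul_bil.2 x) 1 y z; by rewrite !scale1r.
Qed.

HB.instance Definition _ := GRing.Zmodule_isNzRing.Build cross
  cross_mulA cross_mul1r cross_mulr1 cross_mulDl cross_mulDr cross_one_neq0.

Fact cross_scaleAl (c : k) (x y : cross) : c *: (x * y) = c *: x * y.
Proof. exact: (esym (scalable_linear (cross_mul_bil.1 y) c _)). Qed.

HB.instance Definition _ :=
  GRing.Lmodule_isLalgebra.Build k cross cross_scaleAl.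

Fact cross_scaleAr (c : k) (x y : cross) : c *: (x * y) = x * (c *: y).
Proof. exact: (esym (scalable_linear (cross_mul_bil.2 x) c _)). Qed.

HB.instance Definition _ :=
  GRing.Lalgebra_isAlgebra.Build k cross cross_scaleAr.

Definition cross_i0 (a : A) : cross := a ⊗ 1.

Lemma crossM_i0l a b eta : cross_i0 a * (b ⊗ eta : cross) = (a * b) ⊗ eta.
Proof.
rewrite [LHS]cross_mul_tens; have lh : linear (fun x => (a * x) ⊗ eta) by lin.
rewrite -[in RHS](counitr b) [RHS](sw_lin _ _ lh).
apply: eq_sw => b1 b2; rewrite La_act_unit -scalerAl mul1r.
by rewrite (scalable_linear lh) tensZr.
Qed.

Lemma crossM_i0r a eta b : (a ⊗ eta : cross) * cross_i0 b =
  \sw_(b1, b2 <- coprod b) ((a * b1) ⊗ act eta b2).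
Proof.
by rewrite [LHS]cross_mul_tens; apply: eq_sw => b1 b2; rewrite mulr1.
Qed.

Lemma crossM_1r a eta zeta :
  (a ⊗ eta : cross) * (1 ⊗ zeta : cross) = a ⊗ (eta * zeta).
Proof.
have ab := La_act_bil P.
rewrite [LHS]cross_mul_tens sw_coprod1; last by lin.
by rewrite (act1 (La_actP P)) mulr1.
Qed.

Fact cross_i0_linear : linear cross_i0.
Proof. exact: (tens_bilinear A P).1. Qed.

HB.instance Definition _ :=
  GRing.isLinear.Build k A cross *:%R cross_i0 cross_i0_linear.

Fact cross_i0_monoid : monoid_morphism cross_i0.
Proof. by split=> // a b; rewrite crossM_i0l. Qed.

HB.instance Definition _ :=
  GRing.isMonoidMorphism.Build A cross cross_i0 cross_i0_monoid.

Definition cross_i1 (y : A ⊗ L1 C) : cross := tmap id j y.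

Fact cross_i1_linear : linear cross_i1.
Proof. by apply: tmap_linear; lin. Qed.

HB.instance Definition _ :=
  GRing.isLinear.Build k (A ⊗ L1 C)%type cross *:%R cross_i1 cross_i1_linear.

Lemma cross_i1_tens a v : cross_i1 (a ⊗ v) = a ⊗ j v.
Proof. by apply: tmap_tens; lin. Qed.

Definition cross_diff : cross -> cross := @cross_d _ _ _ P.

Fact cross_diff_linear : linear cross_diff.
Proof. by rewrite /cross_diff /cross_d; lin. Qed.

HB.instance Definition _ :=
  GRing.isLinear.Build k cross cross *:%R cross_diff cross_diff_linear.

Lemma cross_diff_tens a eta : cross_diff (a ⊗ eta) =
  \sw_(a1, a2 <- coprod a) (a1 ⊗ (dform a2 * eta)) + a ⊗ delta eta.
Proof. by rewrite [LHS]tlift_tens //; lin. Qed.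

Definition cross_coact (x : cross) : (A ⊗ cross)%type := free_coact x.

Fact cross_coact_linear : linear cross_coact.
Proof. exact: free_coact_linear. Qed.

HB.instance Definition _ :=
  GRing.isLinear.Build k cross (A ⊗ cross)%type *:%R cross_coact
    cross_coact_linear.

Lemma cross_coact_tens a eta : cross_coact (a ⊗ eta) =
  \sw_(a1, a2 <- coprod a) (a1 ⊗ (a2 ⊗ eta : cross)).
Proof. by rewrite [LHS]tlift_tens //; lin. Qed.

Definition cross_gr n (x : cross) : Prop := in_tensor_r (La_gr (l := P) n) x.

Lemma cross_gr_tens n a eta : La_gr n eta -> cross_gr n (a ⊗ eta).
Proof. exact: in_tensor_r_tens. Qed.

(** Tensoring the projectors of [P] with the identity of [A] shows that the subspaces [cross_gr n]
    form a direct sum, without a basis of [A]. *)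
Lemma cross_gproj p : is_grading_proj (@La_gr _ _ _ P) p ->
  is_grading_proj cross_gr (fun n => tmap id (p n)).
Proof.
move=> pP; have pl := gproj_linear pP.
have tl n : linear (tmap id (p n) : cross -> cross) by apply: tmap_linear; lin.
split=> [n|n x|n x|m n x mn|x]; first exact: tl.
- by apply: in_tensor_r_sum => q; apply: cross_gr_tens; apply: gproj_gr pP _ _.
- by apply: in_tensor_r_id => // w; apply: gproj_id pP _ _.
- move=> gx; rewrite (in_tensor_r_eq (h := fun=> 0) _ _ _ gx); try by lin.
    rewrite -[RHS](sw_zero _ x); apply: eq_sw => a z.
    by rewrite (linear_at0 (lin_tensr _ (@lin_id _ P))).
  by move=> w gw; rewrite (gproj_neq pP mn gw).
- elim/tens_ind: x => [|x y [N xN] [N' yN']|a eta].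
  + exists 0%N => M _; rewrite big1 // => n _; exact: linear_at0 (tl n).
  + exists (maxn N N') => M; rewrite geq_max => /andP[/xN {1}-> /yN' {1}->].
    rewrite -big_split; apply: eq_bigr => n _ /=.
    by rewrite -[x in RHS]scale1r tl scale1r.
  + have [N eN] := gproj_sum pP eta; exists N => M /eN {1}->.
    rewrite (big_morph (tens a) (id1 := 0) (op1 := +%R)).
    * by apply: eq_bigr => n _; rewrite tmap_tens //; lin.
    * by move=> u v; rewrite -[u]scale1r (tens_bilinear A P).2 !scale1r.
    * exact: linear_at0 ((tens_bilinear A P).2 a).
Qed.

Lemma cross_gr_ind n (Q : cross -> Prop) : Q 0 ->
  (forall x y, Q x -> Q y -> Q (x + y)) ->
  (forall a eta, La_gr n eta -> Q (a ⊗ eta)) -> forall x, cross_gr n x -> Q x.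
Proof.
move=> Q0 QD Qt x [s [sQ ->]]; rewrite big_seq.
by apply: big_ind => // p /sQ; apply: Qt.
Qed.

Lemma cross_graded : is_graded_algebra cross_gr.
Proof.
have [p pP] := grading_proj_exists (gr_sum (La_graded P)).
split.
- exact: grading_proj_sum (cross_gproj pP).
- exact/cross_gr_tens/(gr1 (La_graded P)).
- move=> m n x y gx gy.
  elim/cross_gr_ind: gx => [|u v gu gv|a eta ge].
  + rewrite mul0r; apply: (gr0 (grading_proj_sum (cross_gproj pP))).
  + by rewrite mulrDl; apply: in_tensor_r_add.
  + elim/cross_gr_ind: gy => [|u v gu gv|b zeta gz].
    * rewrite mulr0; apply: (gr0 (grading_proj_sum (cross_gproj pP))).
    * by rewrite mulrDr; apply: in_tensor_r_add.
    * rewrite [_ * _]cross_mul_tens; apply: in_tensor_r_sum => q.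
      by apply/cross_gr_tens/(grM (La_graded P)) => //; apply: La_act_gr.
Qed.

Lemma delta1 : delta 1 = 0.
Proof.
have := sder_leibniz (La_sder P) 1 (gr1 (La_graded P)).
by rewrite expr0 !mul1r mulr1 => /eqP; rewrite -subr_eq subrr eq_sym => /eqP.
Qed.

(** Comes from [pi(a b) = pi(a) b + counit(a) pi(b)] and the fact that [omega] and [j] are module
    maps. *)
Lemma dformM a b : dform (a * b) = act (dform a) b + counit a *: dform b.
Proof.
rewrite -La_j_act -omega_act -linearZ -linearD -linearZ -linearD /=.
congr (j (omega C _)); apply: val_inj => /=.
rewrite rmorphM mulrBl scalerBr -scalerA -[_ *: 1 * b]scalerAl mul1r /=.
by rewrite addrA subrK.
Qed.

Lemma dform1 : dform 1 = 0.
Proof.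
have -> : aug_proj (1 : A) = 0.
  by apply: val_inj; rewrite /= rmorph1 scale1r subrr.
by rewrite !linear0.
Qed.

(** Extends the Maurer-Cartan condition from [A^+] to [A]: replacing [a] by [aug_proj a] changes its
    coproduct by a multiple of [1 ⊗ 1], which contributes nothing since [dform 1 = 0]. *)
Lemma delta_dform a :
  delta (dform a) = - \sw_(a1, a2 <- coprod a) (dform a1 * dform a2).
Proof.
apply/eqP; rewrite -addr_eq0; apply/eqP; rewrite -[RHS](La_MC P (aug_proj a)).
congr (_ + _).
have lt : linear (tlift (fun a1 a2 => dform a1 * dform a2) : A ⊗ A -> P).
  by apply: tlift_linear; lin.
rewrite /= -[a]scale1r addrC -scaleNr !linearP /= scale1r coprod1 lt.
by rewrite tlift_tens ?dform1 ?mul0r ?scaler0 ?add0r //; lin.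
Qed.

Lemma cross_diff_i0 a :
  cross_diff (cross_i0 a) = cross_i1 (Omega1_d C a).
Proof.
rewrite cross_diff_tens delta1 (linear_at0 ((tens_bilinear A P).2 a)) addr0.
rewrite (sw_lin _ _ cross_i1_linear); apply: eq_sw => a1 a2.
by rewrite cross_i1_tens mulr1.
Qed.

Lemma gr_dform a : La_gr 1 (dform a).
Proof. by apply/La_j_im; exists (omega C (aug_proj a)). Qed.

(** The term with [delta] twice vanishes, the two terms [dform a2 * delta eta] cancel because
    [dform a2] has odd degree, and the remaining ones cancel by the Maurer-Cartan condition. *)
Lemma cross_diffK x : cross_diff (cross_diff x) = 0.
Proof.
elim/tens_ind: x => [|x y|a eta].
- by rewrite !linear0.
- by rewrite !linearD /= => -> ->; rewrite addr0.
rewrite cross_diff_tens linearD /= cross_diff_tens La_deltadelta tens0r addr0.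
rewrite (sw_lin _ _ cross_diff_linear) -sw_add.
under eq_sw => a1 a2 do rewrite cross_diff_tens -addrA.
rewrite sw_add; rewrite (sw_coassoc (coprod_comodule A)
  (f := fun a1 a2 a3 => a1 ⊗ (dform a2 * (dform a3 * eta)))); try by lin.
rewrite -sw_add -[RHS](sw_zero _ (coprod a)); apply: eq_sw => a1 a2.
rewrite (sder_leibniz (La_sder P) _ (gr_dform a2)) expr1 mulN1r delta_dform.
rewrite -tens_swr -!tensDr mulNr sw_mull.
under eq_sw => a21 a22 do rewrite mulrA.
by rewrite subrK subrr tens0r.
Qed.

End CrossProductAlgebra.

(** * The super-derivation rule on the cross product *)

Section CrossProductDGA.
Variables (k : fieldType) (A : hopfAlgType k) (C : calculus A) (P : ldpair C).

Local Notation j := (La_j P).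
Local Notation delta := (La_delta P).
Local Notation act := (@La_act _ _ _ P).
Local Notation dform a := (j (omega C (aug_proj a))).
Local Notation cross := (cross P).

Lemma cross_leibniz n (u v : cross) : cross_gr n u ->
  cross_diff (u * v) = cross_diff u * v + (-1) ^+ n * (u * cross_diff v).
Proof.
have ab := La_act_bil P; rewrite signr_scale.
elim/cross_gr_ind => [|x y Ex Ey|a eta ge].
- by rewrite !(mul0r, linear0, scaler0, add0r).
- by rewrite !(mulrDl, linearD) /= Ex Ey ?scalerDr addrACA.
elim/tens_ind: v => [|x y Ex Ey|b zeta].
- by rewrite !(mulr0, linear0, scaler0, add0r).
- by rewrite !(mulrDr, linearD) /= Ex Ey ?scalerDr addrACA.
(* [T] is [a_(1) b_(1) ⊗ (dform a_(2) <| b_(2)) (eta <| b_(3)) zeta], the contribution of the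
   differential of [a], which occurs on both sides. [D] is the first sum in the compatibility
   condition between [delta] and the action. *)
pose T := \sw_(b1, b2 <- coprod b) \sw_(a1, a2 <- coprod a)
  \sw_(b21, b22 <- coprod b2)
    ((a1 * b1) ⊗ (act (dform a2) b21 * act eta b22 * zeta) : cross).
pose D b := \sw_(b1, b2 <- coprod b) (dform b1 * act eta b2).
transitivity (T + \sw_(b1, b2 <- coprod b) ((a * b1) ⊗
  (D b2 * zeta + delta (act eta b2 * zeta)))).
  rewrite [_ * _]cross_mul_tens (sw_lin _ _ (@cross_diff_linear _ _ _ P)).
  under eq_sw => b1 b2 do rewrite cross_diff_tens.
  under [X in _ = _ + X]eq_sw => b1 b2 do rewrite tensDr.
  rewrite !sw_add addrA; congr (_ + _).
  pose F b1 b2 b3 := \sw_(a1, a2 <- coprod a) ((a1 * b1) ⊗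
    (act (dform a2) b2 * act eta b3 * zeta) : cross).
  pose G b1 b2 b3 : cross := (a * b1) ⊗ (dform b2 * act eta b3 * zeta).
  have -> : \sw_(b1, b2 <- coprod b)
      ((a * b1) ⊗ (D b2 * zeta)) =
    \sw_(b1, b2 <- coprod b) \sw_(b11, b12 <- coprod b1) G b11 b12 b2.
    rewrite (sw_coassoc (coprod_comodule A)); try by rewrite /G; lin.
    by apply: eq_sw => b1 b2; rewrite sw_mull tens_swr.
  have -> : T = \sw_(b1, b2 <- coprod b) \sw_(b11, b12 <- coprod b1)
      F b11 b12 b2.
    rewrite (sw_coassoc (coprod_comodule A)); try by rewrite /F; lin.
    by apply: eq_sw => b1 b2; rewrite exchange_sw.
  rewrite -sw_add; apply: eq_sw => b1 b2.
  rewrite sw_coprodM; last by lin.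
  rewrite exchange_sw -sw_add; apply: eq_sw => b11 b12.
  (* [dformM] splits the differential of the product of the legs of [a] and [b]: its first term
     yields [T], and in the second [counit a2] contracts the coproduct of [a], leaving the term of
     [D]. *)
  transitivity (\sw_(a1, a2 <- coprod a) ((a1 * b11) ⊗
      (act (dform a2) b12 * act eta b2 * zeta) + counit a2 *:
      ((a1 * b11) ⊗ (dform b12 * act eta b2 * zeta)) : cross)).
    apply: eq_sw => a1 a2.
    by rewrite dformM mulrDl -scalerAl tensDr tensZr !mulrA.
  rewrite sw_add; congr (_ + _).
  by rewrite (sw_counitr (f := fun x =>
    (x * b11) ⊗ (dform b12 * act eta b2 * zeta))) //; lin.
have -> : cross_diff (a ⊗ eta) * (b ⊗ zeta : cross) =
    T + \sw_(b1, b2 <- coprod b) ((a * b1) ⊗ (act (delta eta) b2 * zeta)).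
  rewrite cross_diff_tens mulrDl [X in _ + X]cross_mul_tens; congr (_ + _).
  rewrite [LHS]sw_mull.
  under eq_sw => a1 a2 do rewrite [_ * _]cross_mul_tens.
  rewrite exchange_sw; apply: eq_sw => b1 b2; apply: eq_sw => a1 a2.
  by rewrite La_act_mul sw_mull tens_swr.
rewrite -addrA; congr (T + _).
rewrite cross_diff_tens mulrDr [X in _ *: (_ + X)]cross_mul_tens.
have -> : (a ⊗ eta : cross) *
    (\sw_(b1, b2 <- coprod b) (b1 ⊗ (dform b2 * zeta)) : cross) =
  \sw_(b1, b2 <- coprod b) ((a * b1) ⊗
    (\sw_(b21, b22 <- coprod b2) (act eta b21 * dform b22) * zeta)).
  rewrite [LHS]sw_mulr.
  under eq_sw => b1 b2 do rewrite [_ * _]cross_mul_tens.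
  rewrite (sw_coassoc (coprod_comodule A)
    (f := fun b1 b2 b3 => (a * b1) ⊗ (act eta b2 * (dform b3 * zeta))));
    try by lin.
  apply: eq_sw => b1 b2; rewrite sw_mull tens_swr.
  by apply: eq_sw => b21 b22; rewrite mulrA.
rewrite -sw_add.
rewrite (sw_lin _ _ (lin_scale _ (@lin_id _ _))) -sw_add.
apply: eq_sw => b1 b2; rewrite -tensDr -tensZr -tensDr; congr (_ ⊗ _).
(* With [T] removed and the first factor [a * b1] split off, the remaining identity in [P] is the
   compatibility condition at [b2], multiplied by [zeta], together with the Leibniz rule of
   [delta]. *)
have /eqP := La_delta_act b2 ge; rewrite subr_eq => /eqP ->.
rewrite (sder_leibniz (La_sder P) _ (La_act_gr b2 ge)) !signr_scale.
rewrite -/(D b2) !mulrDl mulNr -scalerAl scalerDr.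
rewrite -!addrA; congr (_ + _).
by rewrite [RHS]addrCA addKr.
Qed.

End CrossProductDGA.

(** * Covariance of the cross product and its correspondence with the pair *)

Section CrossProductCalculus.
Variables (k : fieldType) (A : hopfAlgType k) (C : calculus A) (P : ldpair C).

Local Notation j := (La_j P).
Local Notation act := (@La_act _ _ _ P).
Local Notation cross := (cross P).
Local Notation coact := (@cross_coact _ _ _ P).

Lemma cross_comodule_algebra : is_comodule_algebra coact.
Proof.
have cl := @cross_coact_linear _ _ _ P.
have ab := La_act_bil P.
have cb := cross_mul_bil P.
split=> [x|x||x y].
- transitivity (\sw_(a, y <- coact x) \sw_(a1, a2 <- coprod a)
    (a1 ⊗ (a2 ⊗ y : (A ⊗ cross)%type))).
    by rewrite [LHS]sw_tmap //; lin.
  rewrite [X in tlift _ X]/cross_coact /free_coact sw_tens; last by lin.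
  rewrite [X in tmap _ _ X]/cross_coact /free_coact [RHS]sw_tens; last by lin.
  apply: eq_sw => a eta.
  rewrite sw_tens; last by lin.
  rewrite [RHS]sw_tens; last by lin.
  transitivity (\sw_(a1, a2 <- coprod a) \sw_(a11, a12 <- coprod a1)
    (a11 ⊗ (a12 ⊗ (a2 ⊗ eta : cross) : (A ⊗ cross)%type))).
    by apply: eq_sw => a1 a2; rewrite tlift_tens //; lin.
  rewrite (sw_coassoc (coprod_comodule A) (f := fun a1 a2 a3 =>
    a1 ⊗ (a2 ⊗ (a3 ⊗ eta : cross) : (A ⊗ cross)%type))); try by lin.
  apply: eq_sw => a1 a2; rewrite tlift_tens; last by lin.
  by rewrite cross_coact_tens tens_swr.
- rewrite -[RHS]sw_id /cross_coact /free_coact sw_tens; last by lin.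
  apply: eq_sw => a eta; rewrite -[in RHS](counitl a) sw_tens; last by lin.
  rewrite (sw_lin _ _ ((tens_bilinear A P).1 eta)).
  by apply: eq_sw => a1 a2; rewrite tlift_tens ?tensZl //; lin.
- by rewrite cross_coact_tens sw_coprod1 //; lin.
have tb := @tmul_bil k A cross.
elim/tens_ind: x => [|u v Eu Ev|a eta].
- by rewrite mul0r linear0 (linear_at0 (tb.1 _)).
- rewrite mulrDl !linearD /= Eu Ev.
  by rewrite -[coact u in RHS]scale1r (tb.1 (coact y)) scale1r.
elim/tens_ind: y => [|u v Eu Ev|b zeta].
- by rewrite mulr0 linear0 (linear_at0 (tb.2 _)).
- rewrite mulrDr !linearD /= Eu Ev.
  by rewrite -[coact u in RHS]scale1r (tb.2 (coact _)) scale1r.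
rewrite [_ * _]cross_mul_tens (sw_lin _ _ cl) !cross_coact_tens.
rewrite (sw_lin _ _ (tb.1 _)).
under [RHS]eq_sw => a1 a2 do rewrite (sw_lin _ _ (tb.2 _)).
transitivity (\sw_(b1, b2 <- coprod b) \sw_(b11, b12 <- coprod b1)
  \sw_(a1, a2 <- coprod a) ((a1 * b11) ⊗
    ((a2 * b12) ⊗ (act eta b2 * zeta) : cross))).
  apply: eq_sw => b1 b2; rewrite cross_coact_tens sw_coprodM; last by lin.
  by rewrite exchange_sw.
rewrite (sw_coassoc (coprod_comodule A) (f := fun b1 b2 b3 =>
  \sw_(a1, a2 <- coprod a) ((a1 * b1) ⊗
    ((a2 * b2) ⊗ (act eta b3 * zeta) : cross)))); try by lin.
rewrite [RHS]exchange_sw; apply: eq_sw => b1 b2.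
rewrite exchange_sw; apply: eq_sw => a1 a2.
by rewrite tmul_tens [_ * (b2 ⊗ zeta : cross)]cross_mul_tens tens_swr.
Qed.

Lemma cross_coact_gr n (x : cross) :
  cross_gr n x -> in_tensor_r (@cross_gr _ _ _ P n) (coact x).
Proof.
elim/cross_gr_ind => [|u v gu gv|a eta ge].
- by rewrite linear0; exists [::]; rewrite big_nil.
- by rewrite linearD; apply: in_tensor_r_add.
- rewrite cross_coact_tens; apply: in_tensor_r_sum => p.
  exact/in_tensor_r_tens/cross_gr_tens.
Qed.

Lemma cross_coact_i0 a :
  coact (cross_i0 P a) = tmap id (@cross_i0 _ _ _ P) (coprod a).
Proof. exact: cross_coact_tens. Qed.

Lemma cross_coact_i1 y :
  coact (cross_i1 P y) = tmap id (@cross_i1 _ _ _ P) (free_coact y).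
Proof.
have lt : linear (tmap id (@cross_i1 _ _ _ P) : A ⊗ (A ⊗ L1 C) -> A ⊗ cross).
  by apply: tmap_linear; lin.
have lf := @free_coact_linear k A (L1 C).
have lc := @cross_coact_linear _ _ _ P.
have li := @cross_i1_linear _ _ _ P.
move: y; apply: tens_eq_linear; [exact: lin_comp lc li|exact: lin_comp lt lf|].
move=> a v; rewrite cross_i1_tens cross_coact_tens.
rewrite /free_coact tlift_tens; last by lin.
rewrite (sw_lin _ _ lt); apply: eq_sw => a1 a2.
by rewrite tmap_tens ?cross_i1_tens //; lin.
Qed.

Lemma cross_coact_diff x :
  coact (cross_diff x) = tmap id (@cross_diff _ _ _ P) (coact x).
Proof.
have lt : linear (tmap id (@cross_diff _ _ _ P) : A ⊗ cross -> A ⊗ cross).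
  by apply: tmap_linear; lin.
have lc := @cross_coact_linear _ _ _ P.
have ld := @cross_diff_linear _ _ _ P.
move: x; apply: tens_eq_linear; [exact: lin_comp lc ld|exact: lin_comp lt lc|].
move=> a eta; rewrite cross_diff_tens linearD cross_coact_tens /=.
rewrite (sw_lin _ _ lc) cross_coact_tens (sw_lin _ _ lt).
under eq_sw => a1 a2 do rewrite cross_coact_tens.
rewrite (sw_coassoc (coprod_comodule A) (f := fun a1 a2 a3 =>
    a1 ⊗ (a2 ⊗ (j (omega C (aug_proj a3)) * eta) : cross))); try by lin.
rewrite -sw_add; apply: eq_sw => a1 a2; rewrite tmap_tens; try by lin.
by rewrite cross_diff_tens tensDr tens_swr.
Qed.

(** A linear retraction of the unit [k -> P], obtained from the degree 0 projector. Tensored with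
    [A], it shows that [a |-> a ⊗ 1] is injective and that its image is the whole degree 0 part. *)
Lemma La_unit_section : exists r : P -> k^o, [/\ linear r,
  forall c, r c%:A = c & forall x, cross_gr (P := P) 0 x ->
    x = cross_i0 P (\sw_(a, eta <- x) ((r eta : k) *: a))].
Proof.
have [p pP] := grading_proj_exists (gr_sum (La_graded P)).
have lf : linear (fun c : k^o => c%:A : P).
  by move=> c x y; rewrite scalerDl scalerA.
have fI : injective (fun c : k^o => c%:A : P).
  move=> c c' /eqP; rewrite -subr_eq0 -scalerBl scaler_eq0 oner_eq0 orbF.
  by rewrite subr_eq0 => /eqP.
have [v|u|r [lr rK fr]] := linear_section lf fI (gproj_linear pP 0).
- by have /La_gr0[c cE] := gproj_gr pP 0 v; exists c.
- by apply: (gproj_id pP); apply/La_gr0; exists u.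
exists r; split=> // x gx.
rewrite -{1}(gproj_id (cross_gproj pP) gx).
rewrite (sw_lin _ _ (@cross_i0_linear _ _ _ P)); apply: eq_sw => a eta.
by rewrite /cross_i0 tensZl -tensZr fr.
Qed.

(** The same in degree 1: a linear retraction of [j] keeps [tmap id j] injective and identifies its
    image with the degree 1 part. *)
Lemma La_j_section : exists r : P -> L1 C, [/\ linear r, cancel j r &
  forall x, cross_gr (P := P) 1 x -> x = cross_i1 P (tmap id r x)].
Proof.
have [p pP] := grading_proj_exists (gr_sum (La_graded P)).
have [v|u|r [lr rK fr]] :=
  linear_section (lin_fun j) (@La_j_inj _ _ _ P) (gproj_linear pP 1).
- by apply/La_j_im; apply: gproj_gr pP _ _.
- by apply: (gproj_id pP); apply/La_j_im; exists u.
exists r; split=> // x gx.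
rewrite -{1}(gproj_id (cross_gproj pP) gx) /cross_i1 tmap_comp; last by lin.
by apply: eq_sw => a eta; rewrite /= fr.
Qed.

#[local] Obligation Tactic := idtac.

Program Definition cross_lcdea : lcdea C :=
  @LCDEA k A C cross (@cross_gr _ _ _ P) (@cross_diff _ _ _ P)
    (@cross_coact _ _ _ P) (@cross_i0 _ _ _ P) (@cross_i1 _ _ _ P)
    (cross_graded P) _ _ _ _ _ _ _ (@cross_diffK _ _ _ P) (cross_diff_i0 P)
    cross_comodule_algebra cross_coact_gr cross_coact_i0 cross_coact_i1
    cross_coact_diff.
Next Obligation.
have [r [lr r1 _]] := La_unit_section.
move=> a b /(congr1 (tlift (fun a eta => (r eta : k) *: a))).
have rb : is_bilinear (fun (a : A) eta => (r eta : k) *: a).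
  split=> [eta|c] x y z; first by rewrite scalerDr !scalerA mulrC.
  by rewrite lr scalerDl scalerA.
by rewrite !tlift_tens // -[1 : P]scale1r r1 !scale1r.
Qed.
Next Obligation.
move=> x; split=> [gx|[a ->]]; last first.
  exact/cross_gr_tens/(gr1 (La_graded P)).
have [r [_ _ rE]] := La_unit_section.
by exists (\sw_(a, eta <- x) ((r eta : k) *: a)); apply: rE.
Qed.
Next Obligation.
have [r [lr rK _]] := La_j_section.
have E : cancel (@cross_i1 _ _ _ P) (tmap id r).
  by move=> y; rewrite /cross_i1 tmap_comp // tmap_id.
exact: can_inj E.
Qed.
Next Obligation.
move=> x; split=> [gx|[y ->]].
  by have [r [_ _ rE]] := La_j_section; exists (tmap id r x); apply: rE.
apply: in_tensor_r_sum => p; apply: in_tensor_r_tens.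
by apply/La_j_im; exists p.2.
Qed.
Next Obligation.
move=> b y; rewrite [in RHS]/cross_i1 /Omega1_lmul /tmap.
rewrite [LHS](sw_lin _ _ (@cross_i1_linear _ _ _ P)) [RHS]sw_mulr.
by apply: eq_sw => a v; rewrite cross_i1_tens [RHS]crossM_i0l.
Qed.
Next Obligation.
move=> y b; rewrite [in RHS]/cross_i1 /Omega1_rmul /tmap.
rewrite [LHS](sw_lin _ _ (@cross_i1_linear _ _ _ P)) [RHS]sw_mull.
apply: eq_sw => a v; rewrite [LHS](sw_lin _ _ (@cross_i1_linear _ _ _ P)).
rewrite [RHS]crossM_i0r; apply: eq_sw => b1 b2.
by rewrite cross_i1_tens La_j_act.
Qed.
Next Obligation.
split=> [n u|n u v]; last exact: cross_leibniz.
elim/cross_gr_ind => [|x y gx gy|a eta ge].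
- by rewrite linear0; apply: (gr0 (gr_sum (cross_graded P))).
- by rewrite linearD; apply: in_tensor_r_add.
rewrite -[GRing.Linear.sort _ _]/(cross_diff _) cross_diff_tens.
apply: in_tensor_r_add.
  apply: in_tensor_r_sum => p; apply: in_tensor_r_tens.
  exact: (grM (La_graded P) (gr_dform P p.2) ge).
exact/cross_gr_tens/(sder_deg (La_sder P)).
Qed.

Definition cross_incl (eta : P) : cross := 1 ⊗ eta.

Fact cross_incl_linear : linear cross_incl.
Proof. exact: (tens_bilinear A P).2. Qed.

HB.instance Definition _ :=
  GRing.isLinear.Build k P cross *:%R cross_incl cross_incl_linear.

Fact cross_incl_monoid : monoid_morphism cross_incl.
Proof. by split=> // a b; rewrite [RHS]crossM_1r. Qed.

HB.instance Definition _ :=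
  GRing.isMonoidMorphism.Build P cross cross_incl cross_incl_monoid.

Lemma cross_map_id (x : A ⊗ P) :
  cross_map (O := cross_lcdea) (P := P) cross_incl x = x.
Proof.
rewrite -[RHS]sw_id; apply: eq_sw => a eta.
by rewrite [LHS]crossM_i0l mulr1.
Qed.

Lemma cross_incl_counit eta : cross_counit (cross_incl eta) = eta.
Proof. by rewrite cross_counit_tens rmorph1 scale1r. Qed.

Lemma cross_counit_gr n x : cross_gr n x -> La_gr n (cross_counit (P := P) x).
Proof.
have lc := @cross_counit_linear _ _ _ P.
have gs := gr_sum (La_graded P).
elim/cross_gr_ind => [|u v gu gv|a eta ge].
- by rewrite (linear_at0 lc); apply: gr0 gs _.
- by rewrite -[u]scale1r lc; apply: gr_lin gs _ _ _ _ _ _.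
- rewrite cross_counit_tens -[_ *: _]addr0.
  exact: gr_lin gs _ _ _ _ ge (gr0 gs n).
Qed.

Lemma cross_correspondence :
  is_correspondence (O := cross_lcdea) (P := P) cross_incl.
Proof.
split.
- exact: can_inj cross_incl_counit.
- move=> x; split=> [cx|[eta ->]]; last first.
    by rewrite /left_invariant [LHS]cross_coact_tens sw_coprod1 //; lin.
  exists (cross_counit x).
  have lt : linear (tmap id (@cross_counit _ _ _ P) : A ⊗ cross -> A ⊗ P).
    by apply: tmap_linear; [lin|exact: cross_counit_linear].
  have lc := @cross_counit_linear _ _ _ P.
  (* Applying [cross_counit] to the second factor of [coact x] gives back [x] by the counit axiom,
     and gives [1 ⊗ cross_counit x] by left invariance. *)
  transitivity (tmap id (@cross_counit _ _ _ P) (coact x)); last first.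
    by rewrite [coact x]cx tmap_tens //; lin.
  rewrite /cross_coact /free_coact (sw_lin _ _ lt) -[LHS]sw_id.
  apply: eq_sw => a eta; rewrite (sw_lin _ _ lt) -[in LHS](counitr a).
  rewrite (sw_lin _ _ ((tens_bilinear A P).1 eta)); apply: eq_sw => a1 a2.
  by rewrite tmap_tens ?cross_counit_tens ?tensZl ?tensZr //; lin.
- move=> n eta; split; first exact: cross_gr_tens.
  by move/cross_counit_gr; rewrite cross_incl_counit.
- by move=> v; rewrite [RHS]cross_i1_tens.
(* Both sides are [S(a_(1)) a_(2) ⊗ (eta <| a_(3))]: the antipode axiom contracts it to the left
   side, and the cross product formula gives the right side. *)
- move=> eta a; transitivity (\sw_(a1, a2 <- coprod a)
    \sw_(a21, a22 <- coprod a2) ((antipode a1 * a21) ⊗ act eta a22) : cross).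
    have ab := La_act_bil P.
    rewrite -(sw_coassoc (coprod_comodule A) (f := fun a1 a2 a3 =>
      (antipode a1 * a2) ⊗ act eta a3)); try by lin.
    rewrite -[in LHS](counitl a) (sw_lin _ _ (ab.2 eta)) [LHS]tens_swr.
    apply: eq_sw => a1 a2.
    rewrite -(sw_lin (h := fun x => x ⊗ act eta a2)); last by lin.
    by rewrite antipodel tensZl (scalable_linear (ab.2 eta)) tensZr.
  apply: eq_sw => a1 a2.
  rewrite [cross_i0 P _ * _]crossM_i0l mulr1.
  by rewrite [RHS]crossM_i0r.
- move=> eta; rewrite [RHS]cross_diff_tens sw_coprod1; last by lin.
  by rewrite dform1 mul0r tens0r add0r.
(* For this [iota] the cross map is the identity, so the remaining conditions hold by
   construction. *)
- by exists id => x; rewrite cross_map_id.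
- exact: cross_map_id.
- by move=> x y; rewrite !cross_map_id.
- by move=> n x; rewrite cross_map_id.
- by move=> x; rewrite !cross_map_id.
- by move=> x; rewrite cross_map_id tmap_id //; exact: cross_map_id.
Qed.

End CrossProductCalculus.

Lemma ldpair_corresponds (k : fieldType) (A : hopfAlgType k) (C : calculus A)
  (P : ldpair C) : exists O : lcdea C, corresponds O P.
Proof.
by exists (cross_lcdea P), (@cross_incl _ _ _ P); apply: cross_correspondence.
Qed.

(** * Isomorphisms *)

Section CrossIsomorphism.
Variables (k : fieldType) (A : hopfAlgType k) (C : calculus A).
Variables (P P' : ldpair C) (g : {lrmorphism P -> P'}) (gP : is_ldpair_iso g).

Lemma cross_mul_iso (x y : A ⊗ P) :
  tmap id g (cross_mul x y) = cross_mul (tmap id g x) (tmap id g y).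
Proof.
have lt : linear (tmap id g : A ⊗ P -> A ⊗ P') by apply: tmap_linear; lin.
have ab := La_act_bil P'.
rewrite /cross_mul sw_tmap ?(sw_lin _ _ lt); last by lin.
apply: eq_sw => a eta; rewrite sw_tmap ?(sw_lin _ _ lt); last by lin.
apply: eq_sw => b zeta; rewrite (sw_lin _ _ lt); apply: eq_sw => b1 b2.
by rewrite tmap_tens; try lin; rewrite (rmorphM g) /= (ldp_iso_act gP).
Qed.

Lemma cross_d_iso (x : A ⊗ P) :
  tmap id g (cross_d x) = cross_d (tmap id g x).
Proof.
have lt : linear (tmap id g : A ⊗ P -> A ⊗ P') by apply: tmap_linear; lin.
rewrite /cross_d [RHS]sw_tmap ?(sw_lin _ _ lt); last by lin.
apply: eq_sw => a eta; rewrite -[X in tmap _ _ (X + _)]scale1r lt scale1r.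
rewrite (sw_lin _ _ lt) tmap_tens; try by lin.
rewrite (ldp_iso_delta gP); congr (_ + _); apply: eq_sw => a1 a2.
by rewrite tmap_tens; try lin; rewrite (rmorphM g) /= (ldp_iso_j gP).
Qed.

Lemma free_coact_iso (x : A ⊗ P) :
  tmap id (tmap id g) (free_coact x) = free_coact (tmap id g x).
Proof.
have lg : linear (tmap id g : A ⊗ P -> A ⊗ P') by apply: tmap_linear; lin.
have lt : linear (tmap id (tmap id g) : A ⊗ (A ⊗ P) -> A ⊗ (A ⊗ P')).
  by apply: tmap_linear; lin.
rewrite /free_coact [RHS]sw_tmap ?(sw_lin _ _ lt); last by lin.
apply: eq_sw => a eta; rewrite (sw_lin _ _ lt); apply: eq_sw => a1 a2.
by rewrite !tmap_tens //; lin.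
Qed.

Lemma tmap_iso_can (h : P' -> P) : cancel h g -> cancel g h ->
  cancel (tmap id g : A ⊗ P -> A ⊗ P') (tmap id h).
Proof.
move=> gK hK t; have lh := linear_can (lin_fun g) (can_inj hK) gK.
by rewrite tmap_comp // tmap_id.
Qed.

Variables (O O' : lcdea C) (iota : {lrmorphism P -> O})
  (iota' : {lrmorphism P' -> O'}).
Hypotheses (iotaP : is_correspondence iota) (iotaP' : is_correspondence iota').

Lemma lcdea_iso_of_ldpair : lcdea_iso O O'.
Proof.
have lg : linear (tmap id g : A ⊗ P -> A ⊗ P') by apply: tmap_linear; lin.
have [h gK hK] := ldp_iso_bij gP.
have lh := linear_can (lin_fun g) (can_inj gK) hK.
have tgK : cancel (tmap id g : A ⊗ P -> A ⊗ P') (tmap id h).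
  exact: tmap_iso_can.
have thK : cancel (tmap id h : A ⊗ P' -> A ⊗ P) (tmap id g).
  by move=> t; rewrite tmap_comp ?tmap_id //; lin.
have cl := cross_map_linear (lin_fun iota).
have cl' := cross_map_linear (lin_fun iota').
have ct a eta := cross_map_tens a eta (lin_fun iota).
have ct' a eta := cross_map_tens a eta (lin_fun iota').
have [ci cK ciK] := corr_cross_bij iotaP.
have [ci' cK' ciK'] := corr_cross_bij iotaP'.
(* The map [tmap id g] respects the cross product structures. Conjugated by the two cross maps it
   becomes [f0], and [f0c] reduces each property of [f0] to one of [tmap id g]. *)
pose f0 x := cross_map iota' (tmap id g (ci x)).
have f0c y : f0 (cross_map iota y) = cross_map iota' (tmap id g y).
  by rewrite /f0 cK.
have lf0 : linear f0.
  apply: lin_comp cl' _; apply: lin_comp lg _.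
  exact: linear_can cl (can_inj cK) ciK.
have mf0 : monoid_morphism f0.
  split; first by rewrite -(corr_cross_one iotaP) f0c tmap_tens ?rmorph1
    ?(corr_cross_one iotaP') //; lin.
  move=> x y; rewrite -[x]ciK -[y]ciK -(corr_cross_mul iotaP) !f0c.
  by rewrite cross_mul_iso (corr_cross_mul iotaP').
have [f fE] := lrmorphism_exists lf0 mf0.
exists f; split.
- apply: (eq_bij (f := f0)) => //.
  apply: bij_comp (corr_cross_bij iotaP') _; apply: bij_comp; last first.
    by exists (cross_map iota).
  by exists (tmap id h).
- move=> n x; rewrite fE -[x]ciK f0c.
  rewrite -(corr_cross_gr iotaP) -(corr_cross_gr iotaP'); split.
    by apply: in_tensor_r_tmap; try lin; move=> w /(ldp_iso_gr gP).
  move=> gx; rewrite -[ci x]tgK; apply: in_tensor_r_tmap gx; try by lin.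
  by move=> w gw; apply/(ldp_iso_gr gP); rewrite hK.
- move=> x; rewrite !fE -[x]ciK -(corr_cross_d iotaP) !f0c.
  by rewrite cross_d_iso (corr_cross_d iotaP').
- move=> x; rewrite fE -[x]ciK f0c (corr_cross_coact iotaP') -free_coact_iso.
  rewrite (corr_cross_coact iotaP) !tmap_comp //; last by lin.
  by apply: eq_sw => a y; rewrite /= fE f0c.
- move=> a; rewrite fE -[Om_i0 O a]mulr1 -(rmorph1 iota) -ct f0c.
  rewrite tmap_tens; try by lin.
  by rewrite ct' !rmorph1 mulr1.
- move=> y; rewrite fE -[y]sw_id (sw_lin _ _ (lin_fun _)) (sw_lin _ _ lf0).
  rewrite (sw_lin _ _ (lin_fun _)); apply: eq_sw => a v; rewrite !i1E /linv_j.
  rewrite -(corr_j iotaP) -ct f0c tmap_tens; try by lin.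
  by rewrite ct' /= (ldp_iso_j gP) (corr_j iotaP').
Qed.

End CrossIsomorphism.

Section InvariantIsomorphism.
Variables (k : fieldType) (A : hopfAlgType k) (C : calculus A).
Variables (P P' : ldpair C) (O O' : lcdea C).
Variables (iota : {lrmorphism P -> O}) (iota' : {lrmorphism P' -> O'}).
Hypotheses (iotaP : is_correspondence iota) (iotaP' : is_correspondence iota').
Variables (f : {lrmorphism O -> O'}) (fP : is_lcdea_iso f).

Lemma left_invariant_iso x : left_invariant x <-> left_invariant (f x).
Proof.
have [h fK hK] := dea_iso_bij fP.
have lh := linear_can (lin_fun f) (can_inj fK) hK.
rewrite /left_invariant (dea_iso_coact fP); split=> [->|].
  by rewrite tmap_tens //; lin.
move/(congr1 (tmap id h)); rewrite tmap_comp // tmap_id //.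
by rewrite tmap_tens ?fK //; lin.
Qed.

Lemma ldpair_iso_of_lcdea : ldpair_iso P P'.
Proof.
have gex eta : exists eta', f (iota eta) = iota' eta'.
  apply/(corr_im iotaP')/left_invariant_iso/(corr_im iotaP).
  by exists eta.
(* [f] preserves left-invariant forms, so [f (iota eta)] has a preimage under [iota']. Injectivity
   of [iota'] then gives linearity, multiplicativity and the compatibilities of [g0]. *)
pose g0 eta := projT1 (cid (gex eta)).
have g0E eta : iota' (g0 eta) = f (iota eta) by rewrite /g0; case: cid.
have iI := corr_inj iotaP; have iI' := corr_inj iotaP'.
have fI := bij_inj (dea_iso_bij fP).
have lg0 : linear g0 by move=> c x y; apply: iI'; rewrite g0E !linearP /= !g0E.
have mg0 : monoid_morphism g0.
  split=> [|x y]; apply: iI'; first by rewrite g0E !rmorph1.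
  by rewrite g0E !rmorphM /= !g0E.
have [g gE] := lrmorphism_exists lg0 mg0.
have igE eta : iota' (g eta) = f (iota eta) by rewrite gE g0E.
have gI : injective g by move=> x y /(congr1 iota'); rewrite !igE => /fI/iI.
have gS eta' : exists eta, g eta = eta'.
  have [h fK hK] := dea_iso_bij fP.
  have /(corr_im iotaP)[eta etaE] : left_invariant (h (iota' eta')).
    apply/left_invariant_iso; rewrite hK.
    by apply/(corr_im iotaP'); exists eta'.
  by exists eta; apply: iI'; rewrite igE -etaE hK.
exists g; split.
- pose h eta' := projT1 (cid (gS eta')).
  have hK : cancel h g by rewrite /h => eta'; case: cid.
  by exists h => // eta; apply: gI; rewrite hK.
- move=> n x; rewrite (corr_gr iotaP) (dea_iso_gr fP) -igE.
  by rewrite (corr_gr iotaP').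
- move=> x a; apply: iI'; rewrite igE (corr_act iotaP) (corr_act iotaP').
  rewrite (sw_lin _ _ (lin_fun f)); apply: eq_sw => a1 a2.
  by rewrite !rmorphM /= igE !(dea_iso_i0 fP).
- move=> x; apply: iI'.
  by rewrite igE (corr_delta iotaP) (corr_delta iotaP') (dea_iso_d fP) igE.
- move=> v; apply: iI'.
  by rewrite igE (corr_j iotaP) (corr_j iotaP') (dea_iso_i1 fP).
Qed.

End InvariantIsomorphism.

(** The correspondence is a bijection between isomorphism classes: each side has a partner, and
    partners of isomorphic objects are isomorphic, in both directions. *)
Theorem proposition3p2 (k : fieldType) (char_k : 2%N \notin [pchar k]%R)
    (A : hopfAlgType k) (C : calculus A) :
  [/\ forall O : lcdea C, exists P : ldpair C, corresponds O P,
      forall P : ldpair C, exists O : lcdea C, corresponds O P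
    & forall (O O' : lcdea C) (P P' : ldpair C),
        corresponds O P -> corresponds O' P' ->
        (lcdea_iso O O' <-> ldpair_iso P P')].
Proof.
split; [exact: lcdea_corresponds|exact: ldpair_corresponds|].
move=> O O' P P' [iota iotaP] [iota' iotaP']; split=> [[f fP]|[g gP]].
- exact: (ldpair_iso_of_lcdea iotaP iotaP' fP).
- exact: (lcdea_iso_of_ldpair gP iotaP iotaP').
Qed.
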